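(* Let $\mathcal C$ be a braided unital monoidal Ab-category and let $(A,m,\eta,\sigma)$ be a ribbon algebra in $\mathcal C$. For $n\ge0$ let $C_n=A^{\otimes(n+1)}$, an object of the strict extension $\bar{\mathcal C}$, and let $d_i=d_i^{(n)}:C_n\to C_{n-1}$ ($n\geq 1$), $s_i=s_i^{(n)}:C_n\to C_{n+1}$ ($0\le i\le n$) and $\lambda=\lambda_n:C_n\to C_n$ be the morphisms of $\bar{\mathcal C}$ defined in the context. Then on $C_n$ (whenever the morphisms involved are defined): (i) $d_id_j=d_{j-1}d_i$ for $0\le i<j\le n$; (ii) $s_is_j=s_{j+1}s_i$ for $0\le i\le j\le n$; (iii) $d_is_j=s_{j-1}d_i$ if $i<j$; $d_is_j=\mathrm{id}$ if $i=j$ or $i=j+1$; $d_is_j=s_jd_{i-1}$ if $i>j+1$; (iv) $d_i\lambda=-\lambda d_{i-1}$ for $1\le i\le n$, and $d_0\lambda=(-1)^nd_n$; (v) $s_i\lambda=-\lambda s_{i-1}$ for $1\le i\le n$, and $s_0\lambda=(-1)^n\lambda^2s_n$; (vi) $d_i\lambda^{n+1}=\lambda^nd_i$ for $0\le i\le n$; (vii) $s_i\lambda^{n+1}=\lambda^{n+2}s_i$ for $0\le i\le n$. (Here each $d_i,s_i,\lambda$ carries the superscript/subscript dictated by its source; e.g. (vi) reads $d_i^{(n)}\lambda_n^{n+1}=\lambda_{n-1}^nd_i^{(n)}$.)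
   Context: Braided monoidal Ab-category: a category $\mathcal C$ with a functor $\otimes:\mathcal C\times\mathcal C\to\mathcal C$, natural isomorphisms $\Phi_{U,V,W}:U\otimes(V\otimes W)\to(U\otimes V)\otimes W$ (pentagon identity) and $\Psi_{U,V}:U\otimes V\to V\otimes U$ (two hexagon identities), and a unit object $\mathbf 1$. It is assumed that $U\otimes\mathbf 1=\mathbf 1\otimes U=U$, that $\Phi_{U,V,W}=\mathrm{id}$ when one of $U,V,W$ is $\mathbf 1$, and similarly $\Psi_{U,\mathbf 1}=\Psi_{\mathbf 1,U}=\mathrm{id}$. All $\mathrm{Hom}(U,V)$ are abelian groups with composition and tensor product of morphisms bilinear. Bracketings: $\Lambda_1=\{\mathrm{id}\}$, $\Lambda_2=\{\otimes\}$, and for $n>2$, $\Lambda_n$ is the set of pairs $(\alpha,\beta)$ with $\alpha\in\Lambda_k,\beta\in\Lambda_l$, $k,l<n$, $k+l=n$. For $\alpha\in\Lambda_n$, $(U_1\otimes\cdots\otimes U_n;\alpha)$ is the object of $\mathcal C$ obtained by bracketing the $n$-fold tensor product according to $\alpha$; thus the object for $(\alpha,\beta)$ is $(U_1\otimes\cdots\otimes U_k;\alpha)\otimes(U_{k+1}\otimes\cdots\otimes U_n;\beta)$. By Mac Lane's coherence theorem there is a unique family of isomorphisms $I^\alpha_\beta(U_1,\dots,U_m):(U_1\otimes\cdots\otimes U_m;\alpha)\to(U_1\otimes\cdots\otimes U_m;\beta)$ with $I^\alpha_\beta=\mathrm{id}$ for $m=1,2$, $I^\beta_\gamma I^\alpha_\beta=I^\alpha_\gamma$,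 $I^{\alpha_1}_{\alpha_2}\otimes I^{\beta_1}_{\beta_2}=I^{(\alpha_1,\beta_1)}_{(\alpha_2,\beta_2)}$ and $I^{(\mathrm{id},\otimes)}_{(\otimes,\mathrm{id})}=\Phi$. Strict extension $\bar{\mathcal C}$: objects are formal words $U_1\otimes\cdots\otimes U_n$, $n\ge1$, of objects of $\mathcal C$, where $U_i\neq\mathbf 1$ for all $i$ if $n>1$. Morphisms $U_1\otimes\cdots\otimes U_m\to V_1\otimes\cdots\otimes V_n$ are equivalence classes $[f]$ of morphisms $f:(U_1\otimes\cdots\otimes U_m;\alpha)\to(V_1\otimes\cdots\otimes V_n;\beta)$ of $\mathcal C$ ($\alpha\in\Lambda_m,\beta\in\Lambda_n$ arbitrary), where $f_1\sim f_2$ iff $f_2=I^{\beta_1}_{\beta_2}f_1I^{\alpha_2}_{\alpha_1}$. Each class has exactly one representative $f^\alpha_\beta$ for each $(\alpha,\beta)$. Composition: $gf=[g^\beta_\gamma f^\alpha_\beta]$; sum: $[f^\alpha_\beta+g^\alpha_\beta]$. The tensor product of objects is concatenation of words, with $\mathbf 1$ as strict unit; $f\otimes f'=[f^\alpha_\beta\otimes f'^{\alpha'}_{\beta'}]$ regarded as a morphism with bracketings $(\alpha,\alpha')$, $(\beta,\beta')$. The braiding of $\bar{\mathcal C}$ (also written $\Psi$) between $U_1\otimes\cdots\otimes U_m$ and $V_1\otimes\cdots\otimes V_n$ is the class of $\Psi_{(U_1\otimes\cdots\otimes U_m;\alpha),(V_1\otimes\cdots\otimes V_n;\beta)}$. With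 this $\bar{\mathcal C}$ is a strict braided monoidal Ab-category. An algebra in $\mathcal C$ is an object $A$ of $\mathcal C$ with morphisms $m:A\otimes A\to A$, $\eta:\mathbf 1\to A$ such that $m(\mathrm{id}\otimes m)=m(m\otimes\mathrm{id})$ as morphisms $A\otimes A\otimes A\to A$ of $\bar{\mathcal C}$, and $m(\mathrm{id}\otimes\eta)=m(\eta\otimes\mathrm{id})=\mathrm{id}$. A ribbon algebra is an algebra with an automorphism $\sigma:A\to A$ (of the object $A$) such that $m(\sigma\otimes\sigma)\Psi_{A,A}\Psi_{A,A}=\sigma m$ and $\sigma\eta=\eta$. The morphisms, in $\bar{\mathcal C}$ (with $\mathrm{id}_k=\mathrm{id}_{A^{\otimes k}}$): $d_i^{(n)}=\mathrm{id}_i\otimes m\otimes\mathrm{id}_{n-1-i}$ for $0\le i\le n-1$; $d_n^{(n)}=(m\otimes\mathrm{id}_{n-1})(\sigma\otimes\mathrm{id}_n)\Psi_{A^{\otimes n},A}$; $s_i^{(n)}=\mathrm{id}_{i+1}\otimes\eta\otimes\mathrm{id}_{n-i}$ for $0\le i\le n$; $\lambda_n=(-1)^n(\sigma\otimes\mathrm{id}_n)\Psi_{A^{\otimes n},A}$ (so $\lambda_0=\sigma$). *)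

(* Defs.v *)
From HB Require Import structures.
From mathcomp Require Import all_boot all_algebra.
From mathcomp Require Import boolp.

Set Implicit Arguments.
Unset Strict Implicit.
Unset Printing Implicit Defensive.

Import GRing.Theory.
Local Open Scope ring_scope.
Local Open Scope quotient_scope.

(* The identity morphism of an object, seen as a morphism between two objects
   that are equal but not convertible.                                        *)
Definition id_along (T : Type) (H : T -> T -> Type) (i : forall U, H U U)
    (U V : T) (e : U = V) : H U V :=
  match e in _ = V return H U V with erefl => i U end.

(* The equalities of objects tens1o, tenso1 are strict; the laws that involve
   them are stated along arbitrary proofs e of the relevant equalities (these
   proofs exist, and are unique by proof irrelevance).  tens1m and tensm1 say
   that tensoring with one is the identity functor also on morphisms.         *)
Record braidedAbCategory := BraidedAbCategory {
  obj :> Type;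
  hom : obj -> obj -> zmodType;
  idm : forall U, hom U U;
  comp : forall U V W, hom V W -> hom U V -> hom U W;
  idto := fun U V (e : U = V) =>
    id_along (H := fun U V => hom U V : Type) idm e : hom U V;
  comp1m : forall U V (f : hom U V), comp (idm V) f = f;
  compm1 : forall U V (f : hom U V), comp f (idm U) = f;
  compA : forall U V W X (h : hom W X) (g : hom V W) (f : hom U V),
    comp h (comp g f) = comp (comp h g) f;
  compDl : forall U V W (g g' : hom V W) (f : hom U V),
    comp (g + g') f = comp g f + comp g' f;
  compDr : forall U V W (g : hom V W) (f f' : hom U V),
    comp g (f + f') = comp g f + comp g f';

  tens : obj -> obj -> obj;
  tensm : forall U U' V V', hom U U' -> hom V V' -> hom (tens U V) (tens U' V');
  tensm_id : forall U V, tensm (idm U) (idm V) = idm (tens U V);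
  tensm_comp : forall U U' U'' V V' V''
      (f' : hom U' U'') (f : hom U U') (g' : hom V' V'') (g : hom V V'),
    tensm (comp f' f) (comp g' g) = comp (tensm f' g') (tensm f g);
  tensmDl : forall U U' V V' (f f' : hom U U') (g : hom V V'),
    tensm (f + f') g = tensm f g + tensm f' g;
  tensmDr : forall U U' V V' (f : hom U U') (g g' : hom V V'),
    tensm f (g + g') = tensm f g + tensm f g';

  one : obj;
  tens1o : forall U, tens one U = U;
  tenso1 : forall U, tens U one = U;
  tens1m : forall U V (f : hom U V) (eU : tens one U = U) (eV : tens one V = V),
    comp (idto eV) (tensm (idm one) f) = comp f (idto eU);
  tensm1 : forall U V (f : hom U V) (eU : tens U one = U) (eV : tens V one = V),
    comp (idto eV) (tensm f (idm one)) = comp f (idto eU);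

  assoc : forall U V W, hom (tens U (tens V W)) (tens (tens U V) W);
  assocV : forall U V W, hom (tens (tens U V) W) (tens U (tens V W));
  assocK : forall U V W, comp (assocV U V W) (assoc U V W) = idm _;
  assocVK : forall U V W, comp (assoc U V W) (assocV U V W) = idm _;
  assoc_nat : forall U U' V V' W W'
      (f : hom U U') (g : hom V V') (h : hom W W'),
    comp (assoc U' V' W') (tensm f (tensm g h)) =
    comp (tensm (tensm f g) h) (assoc U V W);
  pentagon : forall U V W X,
    comp (assoc (tens U V) W X) (assoc U V (tens W X)) =
    comp (tensm (assoc U V W) (idm X))
      (comp (assoc U (tens V W) X) (tensm (idm U) (assoc V W X)));
  assoc1oo : forall V W (e : tens one (tens V W) = tens (tens one V) W),
    assoc one V W = idto e;
  assoco1o : forall U W (e : tens U (tens one W) = tens (tens U one) W),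
    assoc U one W = idto e;
  assocoo1 : forall U V (e : tens U (tens V one) = tens (tens U V) one),
    assoc U V one = idto e;

  braid : forall U V, hom (tens U V) (tens V U);
  braidV : forall U V, hom (tens V U) (tens U V);
  braidK : forall U V, comp (braidV U V) (braid U V) = idm _;
  braidVK : forall U V, comp (braid U V) (braidV U V) = idm _;
  braid_nat : forall U U' V V' (f : hom U U') (g : hom V V'),
    comp (braid U' V') (tensm f g) = comp (tensm g f) (braid U V);
  hexagonl : forall U V W,
    comp (assoc W U V) (comp (braid (tens U V) W) (assoc U V W)) =
    comp (tensm (braid U W) (idm V))
      (comp (assoc U W V) (tensm (idm U) (braid V W)));
  hexagonr : forall U V W,
    comp (assocV V W U) (comp (braid U (tens V W)) (assocV U V W)) =
    comp (tensm (idm V) (braid U W))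
      (comp (assocV V U W) (tensm (braid U V) (idm W)));
  braid_o1 : forall U (e : tens U one = tens one U), braid U one = idto e;
  braid_1o : forall U (e : tens one U = tens U one), braid one U = idto e
}.

Arguments one {_}.
Arguments idto : simpl never.
Notation "g ∘ f" := (comp g f) (at level 40, left associativity) : ring_scope.
Notation "U ⊗ V" := (tens U V) (at level 35, right associativity) : ring_scope.
Notation "f ⊗m g" := (tensm f g) (at level 35, right associativity) : ring_scope.

Section Coherence.
Variable C : braidedAbCategory.
Implicit Types (U V W X Y Z : C).

(* A tree with leaves U_1, ..., U_n, read from left to right, is the same thing
   as a word U_1 ... U_n together with a bracketing of it.                    *)
Inductive btree := Leaf of C | Node of btree & btree.
Implicit Types (a b c t : btree).

Fixpoint leaves t : seq C :=
  match t with Leaf U => [:: U] | Node a b => leaves a ++ leaves b end.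

Fixpoint bobj t : C :=
  match t with Leaf U => U | Node a b => bobj a ⊗ bobj b end.

(* coh_assoc is required for all bracketed words a, b, c, and not only for
   one-letter words: this is needed for uniqueness, see coherence_unique.     *)
Record coherence := Coherence {
  coh : forall a b, leaves a = leaves b -> hom (bobj a) (bobj b);
  coh_iso : forall a b (e : leaves a = leaves b),
    exists g, g ∘ coh e = idm _ /\ coh e ∘ g = idm _;
  coh_id12 : forall a (e : leaves a = leaves a),
    (size (leaves a) <= 2)%N -> coh e = idm _;
  coh_trans : forall a b c (e : leaves a = leaves b) (e' : leaves b = leaves c)
      (e'' : leaves a = leaves c),
    coh e' ∘ coh e = coh e'';
  coh_tens : forall a a' b b' (ea : leaves a = leaves a')
      (eb : leaves b = leaves b') (e : leaves (Node a b) = leaves (Node a' b')),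
    coh e = coh ea ⊗m coh eb;
  coh_assoc : forall a b c
      (e : leaves (Node a (Node b c)) = leaves (Node (Node a b) c)),
    coh e = assoc (bobj a) (bobj b) (bobj c)
}.

Lemma idtoE U (e : U = U) : idto e = idm U.
Proof. by rewrite (Prop_irrelevance e erefl). Qed.

Lemma idto_irr U V (e e' : U = V) : idto e = idto e'.
Proof. by rewrite (Prop_irrelevance e e'). Qed.

Lemma idto_comp U V W (e : U = V) (e' : V = W) :
  idto e' ∘ idto e = idto (etrans e e').
Proof. by subst W; rewrite idtoE comp1m; apply: idto_irr. Qed.

Lemma idtoK U V (e : U = V) (e' : V = U) : idto e' ∘ idto e = idm U.
Proof. by rewrite idto_comp idtoE. Qed.

Lemma idto_tens U U' V V' (e : U = U') (e' : V = V') (e2 : U ⊗ V = U' ⊗ V') :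
  idto e ⊗m idto e' = idto e2.
Proof. by subst U' V'; rewrite !idtoE tensm_id. Qed.

Lemma tens1mE U V (f : hom U V) e e' : idm one ⊗m f =
  idto (U := V) (V := one ⊗ V) e' ∘ f ∘ idto (U := one ⊗ U) (V := U) e.
Proof. by rewrite -compA -tens1m ?tens1o // => eV; rewrite compA idtoK comp1m. Qed.

Lemma tensm1E U V (f : hom U V) e e' : f ⊗m idm one =
  idto (U := V) (V := V ⊗ one) e' ∘ f ∘ idto (U := U ⊗ one) (V := U) e.
Proof. by rewrite -compA -tensm1 ?tenso1 // => eV; rewrite compA idtoK comp1m. Qed.

Lemma tensm_l U U' V V' (f : hom U U') (g : hom V V') :
  f ⊗m g = (f ⊗m idm _) ∘ (idm _ ⊗m g).
Proof. by rewrite -tensm_comp compm1 comp1m. Qed.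

Lemma tensm_r U U' V V' (f : hom U U') (g : hom V V') :
  f ⊗m g = (idm _ ⊗m g) ∘ (f ⊗m idm _).
Proof. by rewrite -tensm_comp compm1 comp1m. Qed.

Lemma tensm_idl U V V' V'' (g : hom V' V'') (f : hom V V') :
  idm U ⊗m (g ∘ f) = (idm U ⊗m g) ∘ (idm U ⊗m f).
Proof. by rewrite -tensm_comp comp1m. Qed.

Lemma tensm_idr U V V' V'' (g : hom V' V'') (f : hom V V') :
  (g ∘ f) ⊗m idm U = (g ⊗m idm U) ∘ (f ⊗m idm U).
Proof. by rewrite -tensm_comp comp1m. Qed.

Fixpoint ltens X (s : seq C) : C := if s is U :: s' then ltens (X ⊗ U) s' else X.

Lemma ltens_cat X s s' : ltens X (s ++ s') = ltens (ltens X s) s'.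
Proof. by elim: s X => //= U s IHs X. Qed.

Fixpoint ltensm X Y (f : hom X Y) (s : seq C) : hom (ltens X s) (ltens Y s) :=
  match s with
  | [::] => f
  | U :: s' => ltensm (f ⊗m idm U) s'
  end.

Lemma ltensm_comp X Y Z (g : hom Y Z) (f : hom X Y) s :
  ltensm (g ∘ f) s = ltensm g s ∘ ltensm f s.
Proof. by elim: s X Y Z g f => //= U s IHs X Y Z g f; rewrite tensm_idr IHs. Qed.

Lemma ltensm_idto X Y (e : X = Y) s (e' : ltens X s = ltens Y s) :
  ltensm (idto e) s = idto e'.
Proof.
by subst Y; rewrite !idtoE; elim: s X {e'} => //= U s IHs X; rewrite tensm_id.
Qed.

Lemma ltensm_cat X Y (f : hom X Y) s s' e e' :
  ltensm f (s ++ s') = idto e' ∘ ltensm (ltensm f s) s' ∘ idto e.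
Proof.
elim: s X Y f e e' => [|U s IHs] X Y f e e' /=; last exact: IHs.
by rewrite !idtoE compm1 comp1m.
Qed.

(* Reassociation of a product X (Y s) into (X Y) s. *)
Fixpoint shift X Y (s : seq C) : hom (X ⊗ ltens Y s) (ltens (X ⊗ Y) s) :=
  match s with
  | [::] => idm _
  | U :: s' => ltensm (assoc X Y U) s' ∘ shift X (Y ⊗ U) s'
  end.

Lemma shift_cat X Y s s' e e' :
  shift X Y (s ++ s') =
  idto e' ∘ ltensm (shift X Y s) s' ∘ shift X (ltens Y s) s' ∘ (idm X ⊗m idto e).
Proof.
elim: s Y e e' => [|U s IHs] Y e e' /=.
  rewrite !idtoE tensm_id compm1 comp1m.
  suff -> : ltensm (idm (X ⊗ Y)) s' = idm _ by rewrite comp1m.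
  by rewrite -[idm _]/(idto erefl) (ltensm_idto erefl erefl).
have e1 : ltens (ltens (X ⊗ (Y ⊗ U)) s) s' = ltens (X ⊗ (Y ⊗ U)) (s ++ s').
  by rewrite ltens_cat.
rewrite (ltensm_cat _ (esym e1) e') (IHs _ e e1) ltensm_comp !compA.
by rewrite -[_ ∘ idto (esym e1) ∘ idto e1]compA idtoK compm1.
Qed.

(* The reassociation of X (U_1 ... U_n) into the left-normed product of
   X, U_1, ..., U_n, and its inverse.                                         *)
Fixpoint flat X t : hom (X ⊗ bobj t) (ltens X (leaves t)) :=
  match t return hom (X ⊗ bobj t) (ltens X (leaves t)) with
  | Leaf U => idm _
  | Node a b => idto (esym (ltens_cat X (leaves a) (leaves b))) ∘
      flat (ltens X (leaves a)) b ∘ (flat X a ⊗m idm (bobj b)) ∘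
      assoc X (bobj a) (bobj b)
  end.

Fixpoint unflat X t : hom (ltens X (leaves t)) (X ⊗ bobj t) :=
  match t return hom (ltens X (leaves t)) (X ⊗ bobj t) with
  | Leaf U => idm _
  | Node a b => assocV X (bobj a) (bobj b) ∘ (unflat X a ⊗m idm (bobj b)) ∘
      unflat (ltens X (leaves a)) b ∘
      idto (ltens_cat X (leaves a) (leaves b))
  end.

Lemma cancelm U V W X (f : hom U V) (g : hom V U) (h : hom U W) (k : hom X U) :
  g ∘ f = idm _ -> h ∘ g ∘ (f ∘ k) = h ∘ k.
Proof. by move=> gf; rewrite compA -(compA h) gf compm1. Qed.

Lemma flatK X t : unflat X t ∘ flat X t = idm _.
Proof.
elim: t X => [U|a IHa b IHb] X /=; first by rewrite comp1m.
rewrite -!compA (compA (idto _)) idtoK comp1m.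
rewrite (compA (unflat _ b)) IHb comp1m (compA (unflat X a ⊗m _)).
by rewrite -tensm_idr IHa tensm_id comp1m assocK.
Qed.

Lemma unflatK X t : flat X t ∘ unflat X t = idm _.
Proof.
elim: t X => [U|a IHa b IHb] X /=; first by rewrite comp1m.
rewrite -!compA (compA (assoc _ _ _)) assocVK comp1m.
rewrite (compA (flat X a ⊗m _)) -tensm_idr IHa tensm_id comp1m.
by rewrite (compA (flat _ b)) IHb comp1m idtoK.
Qed.

Lemma flat_nat X Y (f : hom X Y) t :
  flat Y t ∘ (f ⊗m idm _) = ltensm f (leaves t) ∘ flat X t.
Proof.
elim: t X Y f => [U|a IHa b IHb] X Y f /=; first by rewrite comp1m compm1.
rewrite -!compA -tensm_id assoc_nat (compA (flat Y a ⊗m _)) -tensm_idr IHa.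
rewrite tensm_idr -!compA (compA (flat _ b)) IHb.
rewrite (ltensm_cat _ (ltens_cat _ _ _) (esym (ltens_cat _ _ _))) -!compA.
by rewrite [in RHS](compA (idto (ltens_cat _ _ _))) idtoK comp1m.
Qed.

Lemma flat_shift X Y t :
  flat (X ⊗ Y) t ∘ assoc X Y (bobj t) =
  shift X Y (leaves t) ∘ (idm X ⊗m flat Y t).
Proof.
elim: t X Y => [U|a IHa b IHb] X Y /=.
  by rewrite tensm_id comp1m !compm1.
rewrite -!compA pentagon (compA (flat (X ⊗ Y) a ⊗m _)) -tensm_idr IHa.
rewrite tensm_idr -!compA (compA _ (assoc X _ _)) -assoc_nat.
rewrite (compA (flat _ b)) flat_nat -!compA (compA (flat _ b)) IHb.
rewrite (shift_cat (ltens_cat _ _ _) (esym (ltens_cat _ _ _))) !tensm_idl.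
rewrite -!compA (compA (idm X ⊗m idto _)) -(tensm_idl X (idto _)) idtoK tensm_id comp1m.
by rewrite !compA.
Qed.

Definition norm t : hom (bobj t) (ltens one (leaves t)) :=
  locked (flat one t ∘ idto (esym (tens1o (bobj t)))).

Definition unnorm t : hom (ltens one (leaves t)) (bobj t) :=
  locked (idto (tens1o (bobj t)) ∘ unflat one t).

Lemma normK t : unnorm t ∘ norm t = idm _.
Proof.
by rewrite /norm /unnorm -!lock -compA (compA (unflat _ _)) flatK comp1m idtoK. Qed.

Lemma unnormK t : norm t ∘ unnorm t = idm _.
Proof.
by rewrite /norm /unnorm -!lock -compA (compA (idto _)) idtoK comp1m unflatK.
Qed.

Lemma norm_Node a b :
  norm (Node a b) = idto (esym (ltens_cat one (leaves a) (leaves b))) ∘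
    flat (ltens one (leaves a)) b ∘ (norm a ⊗m idm _).
Proof.
rewrite /norm -!lock /= -!compA; congr (_ ∘ (_ ∘ _)).
have e : one ⊗ (bobj a ⊗ bobj b) = (one ⊗ bobj a) ⊗ bobj b by rewrite !tens1o.
rewrite (assoc1oo e) idto_comp tensm_idr; congr (_ ∘ _).
by rewrite -[idm (bobj b)]/(idto erefl); symmetry; apply: idto_tens.
Qed.

(* The part of norm (Node a b) that only depends on the words. *)
Definition glue X (s : seq C) : hom (X ⊗ ltens one s) (ltens X s) :=
  ltensm (idto (tenso1 X)) s ∘ shift X one s.

Lemma flat_glue X t : flat X t = glue X (leaves t) ∘ (idm X ⊗m norm t).
Proof.
rewrite /glue /norm -lock tensm_idl -!compA (compA (shift _ _ _)) -flat_shift.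
have e : X ⊗ (one ⊗ bobj t) = (X ⊗ one) ⊗ bobj t by rewrite tens1o tenso1.
rewrite (assoco1o e) !compA -flat_nat -!compA.
have e1 : (X ⊗ one) ⊗ bobj t = X ⊗ bobj t by rewrite tenso1.
have e2 : X ⊗ bobj t = X ⊗ (one ⊗ bobj t) by rewrite tens1o.
rewrite (_ : idto _ ⊗m idm _ = idto e1); last first.
  by rewrite -[idm (bobj t)]/(idto erefl); apply: idto_tens.
rewrite (_ : idm _ ⊗m idto _ = idto e2); last first.
  by rewrite -[idm X]/(idto erefl); apply: idto_tens.
by rewrite !idto_comp idtoE compm1.
Qed.

Lemma norm_Node_glue a b :
  norm (Node a b) = idto (esym (ltens_cat one (leaves a) (leaves b))) ∘
    glue (ltens one (leaves a)) (leaves b) ∘ (norm a ⊗m norm b).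
Proof. by rewrite norm_Node flat_glue -!compA -tensm_r. Qed.

Definition mcoh a b (e : leaves a = leaves b) : hom (bobj a) (bobj b) :=
  unnorm b ∘ idto (congr1 (ltens one) e) ∘ norm a.

Lemma norm_mcoh a b (e : leaves a = leaves b) :
  norm b ∘ mcoh e = idto (congr1 (ltens one) e) ∘ norm a.
Proof.
by rewrite /mcoh (compA (norm b)) (compA (norm b)) unnormK comp1m.
Qed.

Lemma norm_inj U t (f g : hom U (bobj t)) : norm t ∘ f = norm t ∘ g -> f = g.
Proof.
by move=> h; rewrite -[f]comp1m -[g]comp1m -normK -[LHS]compA -[RHS]compA h.
Qed.

Lemma mcoh_id a (e : leaves a = leaves a) : mcoh e = idm _.
Proof. by apply: norm_inj; rewrite norm_mcoh idtoE comp1m compm1. Qed.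

Lemma mcoh_trans a b c (e : leaves a = leaves b) (e' : leaves b = leaves c)
    (e'' : leaves a = leaves c) : mcoh e' ∘ mcoh e = mcoh e''.
Proof.
apply: norm_inj; rewrite (compA (norm c)) !norm_mcoh -(compA _ (norm b)).
rewrite norm_mcoh (compA (idto _) (idto _)) idto_comp.
by congr (_ ∘ _); apply: idto_irr.
Qed.

Lemma mcoh_iso a b (e : leaves a = leaves b) :
  exists g, g ∘ mcoh e = idm _ /\ mcoh e ∘ g = idm _.
Proof. by exists (mcoh (esym e)); rewrite !(mcoh_trans _ _ erefl) !mcoh_id. Qed.

Lemma glue_irr s s' u u' (es : s = s') (eu : u = u') e' :
  glue (ltens one s') u' ∘ (idto (congr1 (ltens one) es) ⊗m
                            idto (congr1 (ltens one) eu)) =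
  idto e' ∘ glue (ltens one s) u.
Proof. by subst s' u'; rewrite !idtoE tensm_id compm1 comp1m. Qed.

Lemma mcoh_tens a a' b b' (ea : leaves a = leaves a')
    (eb : leaves b = leaves b') (e : leaves (Node a b) = leaves (Node a' b')) :
  mcoh e = mcoh ea ⊗m mcoh eb.
Proof.
apply: norm_inj; rewrite norm_mcoh !norm_Node_glue.
rewrite -(compA _ (norm a' ⊗m _)) -tensm_comp !norm_mcoh tensm_comp.
rewrite (compA (idto (congr1 _ e))) (compA (_ ∘ glue _ _)); congr (_ ∘ _).
have e1 : ltens (ltens one (leaves a)) (leaves b) =
          ltens (ltens one (leaves a')) (leaves b') by rewrite ea eb.
rewrite -(compA _ (glue _ _)) (glue_irr ea eb e1) !compA !idto_comp.
by congr (_ ∘ _ ∘ _); apply: idto_irr.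
Qed.

Lemma mcoh_assoc a b c
    (e : leaves (Node a (Node b c)) = leaves (Node (Node a b) c)) :
  mcoh e = assoc (bobj a) (bobj b) (bobj c).
Proof.
apply: norm_inj; rewrite norm_mcoh. rewrite !norm_Node !tensm_idr.
have -> : idm (bobj (Node b c)) = idm (bobj b) ⊗m idm (bobj c).
  by rewrite tensm_id.
have e1 : ltens (ltens (ltens one (leaves a)) (leaves b)) (leaves c) =
          ltens (ltens one (leaves a ++ leaves b)) (leaves c).
  by rewrite ltens_cat.
rewrite /= -!compA assoc_nat [in RHS](compA (flat _ c)) flat_nat.
rewrite (ltensm_idto _ e1) -!compA
  !(compA (idto _) (idto _)) !idto_comp.
rewrite compA idto_comp.
by congr (_ ∘ _); apply: idto_irr.
Qed.

(* Opaque: by coherence_unique, its properties determine it. *)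
Definition maclane : coherence.
Proof.
by exists mcoh; [exact: mcoh_iso | move=> a e _; exact: mcoh_id
  | exact: mcoh_trans | exact: mcoh_tens | exact: mcoh_assoc].
Qed.

Lemma coherence_refl (J : coherence) a (e : leaves a = leaves a) :
  coh J e = idm _.
Proof.
have [g [ge _]] := coh_iso J e.
by rewrite -[LHS]comp1m -{1}ge -compA (coh_trans J e e e) ge.
Qed.

Lemma coherence_unique (J K : coherence) a b (e : leaves a = leaves b) :
  coh J e = coh K e.
Proof.
pose good a b := forall e : leaves a = leaves b, coh J e = coh K e.
have good_refl t : good t t by move=> e'; rewrite !coherence_refl.
have good_trans t u v : leaves t = leaves u -> good t u -> good u v -> good t v.
  move=> tu gtu guv tv.
  have uv : leaves u = leaves v by rewrite -tu.
  by rewrite -(coh_trans J tu uv) -(coh_trans K tu uv) gtu guv.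
have good_sym t u : good t u -> good u t.
  move=> gtu ut; have tu := esym ut; have [g [_ gK]] := coh_iso J tu.
  have inv (L : coherence) : coh L ut ∘ coh L tu = idm _.
    by rewrite (coh_trans L tu ut erefl) coherence_refl.
  by rewrite -[LHS]compm1 -[RHS]compm1 -gK !compA inv gtu inv.
have good_node t t' u u' : leaves t = leaves t' -> leaves u = leaves u' ->
    good t t' -> good u u' -> good (Node t u) (Node t' u').
  move=> et eu gt gu e'.
  by rewrite (coh_tens J et eu) (coh_tens K et eu) gt gu.
pose comb := foldl (fun t U => Node t (Leaf U)).
have leaves_comb s t : leaves (comb t s) = leaves t ++ s.
  by elim: s t => [|U s IHs] t /=; rewrite ?cats0 // IHs /= -catA.
have comb_cat t s s' : comb t (s ++ s') = comb (comb t s) s' by apply: foldl_cat.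
have good_comb t u : good (Node t u) (comb t (leaves u)).
  elim: u t => [U|u IHu v IHv] t /=; first exact: good_refl.
  apply: (@good_trans _ (Node (Node t u) v)); first by rewrite /= catA.
    by move=> e'; rewrite !coh_assoc.
  apply: (@good_trans _ (Node (comb t (leaves u)) v)).
  - by rewrite /= leaves_comb.
  - by apply: good_node => //; rewrite leaves_comb.
  - by rewrite comb_cat.
have good_std t U s : leaves t = U :: s -> good t (comb (Leaf U) s).
  elim: t U s => [V|u IHu v _] U s /=; first by case=> -> <-.
  case us: (leaves u) => [|V s'].
    have: (0 < size (leaves u))%N.
      by elim: (u) => //= *; rewrite size_cat addn_gt0; apply/orP; left.
    by rewrite us.
  case=> VU <-; subst V; rewrite comb_cat.
  apply: (@good_trans _ (Node (comb (Leaf U) s') v)).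
  - by rewrite /= leaves_comb us.
  - by apply: good_node; rewrite ?leaves_comb ?us //; apply: IHu.
  - exact: good_comb.
case eb: (leaves b) => [|U s].
  have: (0 < size (leaves b))%N.
    by elim: (b) => //= *; rewrite size_cat addn_gt0; apply/orP; left.
  by rewrite eb.
apply: (@good_trans _ (comb (Leaf U) s)).
- by rewrite leaves_comb e eb.
- by apply: good_std; rewrite e eb.
- exact/good_sym/good_std.
Qed.

End Coherence.

Section StrictExtension.
Variable C : braidedAbCategory.

(* The letters of a word of length > 1 are different from one.  A word is
   represented by the sequence of its letters other than one: the empty sequence
   stands for the one-letter word one, so that the tensor product of words is
   concatenation, with this word as strict unit.                              *)
Record letter := Letter { lobj :> C; letter_neq1 : lobj <> one }.
Definition word := seq letter.

Implicit Types (U V : C) (w : word).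

Definition letters w : seq C := if w is [::] then [:: one] else map lobj w.

Definition wobj U : word :=
  match pselect (U = one) with left _ => [::] | right h => [:: Letter h] end.

Lemma letters_wobj U : letters (wobj U) = [:: U].
Proof. by rewrite /wobj; case: pselect => [->|h]. Qed.

Lemma wobj_one : wobj one = [::].
Proof. by rewrite /wobj; case: pselect. Qed.

Record bracketing w := Bracketing {
  btree_of :> btree C;
  leaves_btree : leaves btree_of = letters w
}.

Definition leafb U : bracketing (wobj U) :=
  @Bracketing (wobj U) (Leaf U) (esym (letters_wobj U)).

Definition oneb : bracketing [::] := @Bracketing [::] (Leaf one) erefl.

(* An arbitrary choice of a bracketing of each word; by add_classE, comp_classE,
   sid_classE, tens_classE and braid_classE, nothing depends on this choice.  *)
Fixpoint rcomb (l : letter) w : btree C :=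
  if w is l' :: w' then Node (Leaf (lobj l)) (rcomb l' w') else Leaf (lobj l).

Lemma leaves_rcomb l w : leaves (rcomb l w) = letters (l :: w).
Proof. by elim: w l => //= l' w IHw l; rewrite IHw. Qed.

Definition std w : bracketing w :=
  if w is l :: w' then Bracketing (leaves_rcomb l w') else oneb.

Lemma oneb_uniq (a : bracketing [::]) : btree_of a = Leaf one.
Proof.
have leaves_gt0 (t : btree C) : (0 < size (leaves t))%N.
  by elim: t => //= t IHt u _; rewrite size_cat addn_gt0 IHt.
case: a => -[U|t u] /= => [[->]//|] /(congr1 size) /= /eqP.
rewrite size_cat; have := leaves_gt0 t; have := leaves_gt0 u.
by case: size => // n; case: size => // m _ _; rewrite addSn addnS.
Qed.

(* The bracketing (a, b) of the tensor product of two words. *)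
Definition join_btree w w' (a : bracketing w) (b : bracketing w') : btree C :=
  if w is [::] then b else if w' is [::] then a else Node a b.

Lemma leaves_join w w' (a : bracketing w) (b : bracketing w') :
  leaves (join_btree a b) = letters (w ++ w').
Proof.
case: w a => [|l w] a; first exact: leaves_btree.
case: w' b => [|l' w'] b; first by rewrite cats0; apply: leaves_btree.
by rewrite /= !leaves_btree /= map_cat.
Qed.

Definition joinb w w' (a : bracketing w) (b : bracketing w') :
  bracketing (w ++ w') := Bracketing (leaves_join a b).

Lemma bobj_joinb w w' (a : bracketing w) (b : bracketing w') :
  bobj (joinb a b) = bobj a ⊗ bobj b.
Proof.
case: w a => [|l w] a; first by rewrite /= oneb_uniq tens1o.
by case: w' b => [|l' w'] b //=; rewrite (oneb_uniq b) tenso1.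
Qed.

Definition rebracket w (a b : bracketing w) : hom (bobj a) (bobj b) :=
  coh (maclane C) (etrans (leaves_btree a) (esym (leaves_btree b))).

Lemma rebracket_id w (a : bracketing w) : rebracket a a = idm _.
Proof. exact: coherence_refl. Qed.

Lemma rebracket_comp w (a b c : bracketing w) :
  rebracket b c ∘ rebracket a b = rebracket a c.
Proof. exact: coh_trans. Qed.

Lemma rebracket_joinb w w' (a b : bracketing w) (a' b' : bracketing w') :
  rebracket (joinb a a') (joinb b b') =
  idto (esym (bobj_joinb b b')) ∘ (rebracket a b ⊗m rebracket a' b') ∘
  idto (bobj_joinb a a').
Proof.
case: w a b => [|l w] [t pt] [u pu].
  have et := oneb_uniq (Bracketing pt); have eu := oneb_uniq (Bracketing pu).
  rewrite /= in et eu; subst t u; rewrite /rebracket coherence_refl.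
  rewrite (tens1mE _ (tens1o _) (esym (tens1o _))) !compA !idto_comp idtoE comp1m.
  rewrite -compA idto_comp idtoE compm1.
  by congr (coh _ _); apply: Prop_irrelevance.
case: w' a' b' => [|l' w'] [t' pt'] [u' pu'].
  have et := oneb_uniq (Bracketing pt'); have eu := oneb_uniq (Bracketing pu').
  rewrite /= in et eu; subst t' u'; rewrite /rebracket (coherence_refl _ _).
  rewrite (tensm1E _ (tenso1 _) (esym (tenso1 _))) !compA !idto_comp idtoE comp1m.
  rewrite -compA idto_comp idtoE compm1.
  by congr (coh _ _); apply: Prop_irrelevance.
rewrite !idtoE comp1m compm1; exact: coh_tens.
Qed.

(* A morphism w -> w' of the strict extension is a class of morphisms of C
   between arbitrary bracketings of w and w'.                                 *)
Record premor w w' := Premor {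
  dom_br : bracketing w;
  cod_br : bracketing w';
  premor_val : hom (bobj dom_br) (bobj cod_br)
}.

HB.instance Definition _ w w' := gen_eqMixin (premor w w').
HB.instance Definition _ w w' := gen_choiceMixin (premor w w').

Definition premor_at w w' (f : premor w w')
    (a : bracketing w) (b : bracketing w') : hom (bobj a) (bobj b) :=
  rebracket (cod_br f) b ∘ premor_val f ∘ rebracket a (dom_br f).

Definition equiv_premor w w' : rel (premor w w') :=
  fun f g => premor_val g == premor_at f (dom_br g) (cod_br g).

Lemma premor_atP w w' (f g : premor w w') a b :
  equiv_premor f g = (premor_at g a b == premor_at f a b).
Proof.
rewrite /equiv_premor; apply/eqP/eqP => [fg|].
  rewrite /premor_at fg /premor_at !compA rebracket_comp -!compA.
  by rewrite rebracket_comp.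
move/(congr1 (fun h => rebracket b (cod_br g) ∘ h ∘ rebracket (dom_br g) a)).
rewrite !compA !rebracket_comp -!compA !rebracket_comp !rebracket_id compm1.
by rewrite comp1m => ->; rewrite compA.
Qed.

Lemma equiv_premor_refl w w' : reflexive (@equiv_premor w w').
Proof. by move=> f; rewrite (premor_atP f f (std w) (std w')). Qed.

Lemma equiv_premor_sym w w' : symmetric (@equiv_premor w w').
Proof. by move=> f g; rewrite !(premor_atP _ _ (std w) (std w')) eq_sym. Qed.

Lemma equiv_premor_trans w w' : transitive (@equiv_premor w w').
Proof.
move=> f g h; rewrite !(premor_atP _ _ (std w) (std w')).
by move=> /eqP -> /eqP ->.
Qed.

Canonical equiv_premor_equiv w w' := EquivRel (@equiv_premor w w')
  (@equiv_premor_refl w w') (@equiv_premor_sym w w') (@equiv_premor_trans w w').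

Definition shom w w' := {eq_quot (@equiv_premor w w')}.
HB.instance Definition _ w w' := Choice.on (shom w w').
HB.instance Definition _ w w' := EqQuotient.on (shom w w').

(* The class [f], and the unique representative of a class with given
   bracketings.                                                               *)
Definition mclass w w' (a : bracketing w) (b : bracketing w')
  (f : hom (bobj a) (bobj b)) : shom w w' := \pi_(shom w w') (Premor f).

Definition rep w w' (f : shom w w') (a : bracketing w)
    (b : bracketing w') : hom (bobj a) (bobj b) :=
  premor_at (repr f) a b.

Lemma repE w w' (a a' : bracketing w) (b b' : bracketing w')
    (f : hom (bobj a) (bobj b)) :
  rep (mclass f) a' b' = rebracket b b' ∘ f ∘ rebracket a' a.
Proof.
have /eqquotP : Premor f = repr (mclass f) %[mod shom w w'] by rewrite reprK.
by rewrite /= (premor_atP _ _ a' b') => /eqP.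
Qed.

Lemma mclassK w w' (a : bracketing w) (b : bracketing w')
  (f : hom (bobj a) (bobj b)) : rep (mclass f) a b = f.
Proof. by rewrite repE !rebracket_id comp1m compm1. Qed.

Lemma repK w w' (f : shom w w') a b : mclass (rep f a b) = f.
Proof.
rewrite -[RHS]reprK; apply/eqquotP; rewrite /= (premor_atP _ _ a b).
by rewrite [X in _ == X]/premor_at /= !rebracket_id comp1m compm1.
Qed.

Lemma rep_inj w w' (f g : shom w w') a b : rep f a b = rep g a b -> f = g.
Proof. by move=> fg; rewrite -(repK f a b) fg repK. Qed.

Lemma rebracket_rep w w' (f : shom w w') a b a' b' :
  rebracket b b' ∘ rep f a b ∘ rebracket a' a = rep f a' b'.
Proof. by rewrite -repE repK. Qed.

Definition sadd w w' (f g : shom w w') : shom w w' :=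
  mclass (rep f (std w) (std w') + rep g (std w) (std w')).
Definition sopp w w' (f : shom w w') : shom w w' :=
  mclass (- rep f (std w) (std w')).
Definition szero w w' : shom w w' := mclass (0 : hom (bobj (std w)) (bobj (std w'))).

Lemma saddA w w' : associative (@sadd w w').
Proof. by move=> f g h; rewrite /sadd !mclassK addrA. Qed.
Lemma saddC w w' : commutative (@sadd w w').
Proof. by move=> f g; rewrite /sadd addrC. Qed.
Lemma sadd0 w w' : left_id (szero w w') (@sadd w w').
Proof. by move=> f; rewrite /sadd mclassK add0r repK. Qed.
Lemma saddN w w' : left_inverse (szero w w') (@sopp w w') (@sadd w w').
Proof. by move=> f; rewrite /sadd mclassK addNr. Qed.

HB.instance Definition _ w w' := GRing.isZmodule.Build (shom w w')
  (@saddA w w') (@saddC w w') (@sadd0 w w') (@saddN w w').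

Definition sid w : shom w w := mclass (idm (bobj (std w))).

Definition sidto w w' (e : w = w') : shom w w' := id_along sid e.

Definition scomp w w' w'' (g : shom w' w'') (f : shom w w') : shom w w'' :=
  mclass (rep g (std w') (std w'') ∘ rep f (std w) (std w')).

Definition join_class w1 w2 w1' w2' (a1 : bracketing w1) (a2 : bracketing w2)
    (b1 : bracketing w1') (b2 : bracketing w2')
    (f : hom (bobj a1 ⊗ bobj a2) (bobj b1 ⊗ bobj b2)) :
    shom (w1 ++ w2) (w1' ++ w2') :=
  @mclass _ _ (joinb a1 a2) (joinb b1 b2)
    (idto (esym (bobj_joinb b1 b2)) ∘ f ∘ idto (bobj_joinb a1 a2)).

Definition stens w1 w1' w2 w2' (f : shom w1 w1') (g : shom w2 w2') :
    shom (w1 ++ w2) (w1' ++ w2') :=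
  join_class (rep f (std w1) (std w1') ⊗m rep g (std w2) (std w2')).

Definition sbraid w w' : shom (w ++ w') (w' ++ w) :=
  join_class (braid (bobj (std w)) (bobj (std w'))).

Lemma add_classE w w' (a : bracketing w) (b : bracketing w')
    (f g : hom (bobj a) (bobj b)) :
  mclass f + mclass g = mclass (f + g).
Proof.
apply: (@rep_inj _ _ _ _ (std w) (std w')).
by rewrite mclassK !repE compDr compDl.
Qed.

Lemma comp_classE w w' w'' (a : bracketing w) (b : bracketing w')
    (c : bracketing w'') (g : hom (bobj b) (bobj c)) (f : hom (bobj a) (bobj b)) :
  scomp (mclass g) (mclass f) = mclass (g ∘ f).
Proof.
apply: (@rep_inj _ _ _ _ (std w) (std w'')); rewrite mclassK !repE -!compA.
by rewrite (compA (rebracket _ b)) rebracket_comp rebracket_id comp1m.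
Qed.

Lemma sid_classE w (a : bracketing w) : mclass (idm (bobj a)) = sid w.
Proof.
apply: (@rep_inj _ _ _ _ (std w) (std w)).
by rewrite mclassK repE compm1 rebracket_comp rebracket_id.
Qed.

Lemma rebracket_joinl w1 w2 (a1 b1 : bracketing w1) (a2 b2 : bracketing w2) :
  rebracket (joinb a1 a2) (joinb b1 b2) ∘ idto (esym (bobj_joinb a1 a2)) =
  idto (esym (bobj_joinb b1 b2)) ∘ (rebracket a1 b1 ⊗m rebracket a2 b2).
Proof. by rewrite rebracket_joinb -compA idtoK compm1. Qed.

Lemma rebracket_joinr w1 w2 (a1 b1 : bracketing w1) (a2 b2 : bracketing w2) :
  idto (bobj_joinb b1 b2) ∘ rebracket (joinb a1 a2) (joinb b1 b2) =
  (rebracket a1 b1 ⊗m rebracket a2 b2) ∘ idto (bobj_joinb a1 a2).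
Proof. by rewrite rebracket_joinb !compA idtoK comp1m. Qed.

Lemma join_classE w1 w2 w1' w2' (a1 c1 : bracketing w1) (a2 c2 : bracketing w2)
    (b1 d1 : bracketing w1') (b2 d2 : bracketing w2')
    (f : hom (bobj a1 ⊗ bobj a2) (bobj b1 ⊗ bobj b2)) :
  join_class f = join_class ((rebracket b1 d1 ⊗m rebracket b2 d2) ∘ f ∘
                             (rebracket c1 a1 ⊗m rebracket c2 a2)).
Proof.
apply: (@rep_inj _ _ _ _ (joinb c1 c2) (joinb d1 d2)).
rewrite mclassK repE -!compA -rebracket_joinr !compA rebracket_joinl.
by rewrite -!compA.
Qed.

Lemma tens_classE w1 w1' w2 w2' (a1 : bracketing w1) (b1 : bracketing w1')
    (a2 : bracketing w2) (b2 : bracketing w2')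
    (f : hom (bobj a1) (bobj b1)) (g : hom (bobj a2) (bobj b2)) :
  stens (mclass f) (mclass g) = join_class (f ⊗m g).
Proof.
rewrite /stens !repE [RHS](@join_classE _ _ _ _ _ (std _) _ (std _) _ (std _) _ (std _)).
by rewrite -!tensm_comp.
Qed.

Lemma braid_classE w w' (a : bracketing w) (b : bracketing w') :
  sbraid w w' = join_class (braid (bobj a) (bobj b)).
Proof.
rewrite /sbraid [LHS](@join_classE _ _ _ _ _ a _ b _ b _ a).
rewrite -braid_nat -compA -tensm_comp !rebracket_comp !rebracket_id tensm_id.
by rewrite compm1.
Qed.

End StrictExtension.

Notation "g ∙ f" := (scomp g f) (at level 40, left associativity) : ring_scope.
Notation "f ⊠ g" := (stens f g) (at level 35, right associativity) : ring_scope.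

(* The classes of morphisms f of C, for f : U -> V, f : one -> V and
   f : U ⊗ V -> W (the word U V has one letter if U or V is one).             *)
Definition emb (C : braidedAbCategory) (U V : C) (f : hom U V) :
    shom (wobj U) (wobj V) :=
  @mclass C _ _ (leafb U) (leafb V) f.

Definition emb_one (C : braidedAbCategory) (V : C) (f : hom one V) :
    shom [::] (wobj V) :=
  @mclass C _ _ (oneb C) (leafb V) f.

Definition emb_tens (C : braidedAbCategory) (U V W : C) (f : hom (U ⊗ V) W) :
    shom (wobj U ++ wobj V) (wobj W) :=
  @mclass C _ _ (joinb (leafb U) (leafb V)) (leafb W)
    (f ∘ idto (bobj_joinb (leafb U) (leafb V))).

Record algebra (C : braidedAbCategory) := Algebra {
  alg_obj :> C;
  amul : hom (alg_obj ⊗ alg_obj) alg_obj;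
  aone : hom one alg_obj;
  amulA : emb_tens amul ∙ (sid (wobj alg_obj) ⊠ emb_tens amul) =
    emb_tens amul ∙ (emb_tens amul ⊠ sid (wobj alg_obj)) ∙ sidto (catA _ _ _);
  amulm1 : forall e : alg_obj = alg_obj ⊗ one,
    amul ∘ (idm alg_obj ⊗m aone) ∘ idto e = idm alg_obj;
  amul1m : forall e : alg_obj = one ⊗ alg_obj,
    amul ∘ (aone ⊗m idm alg_obj) ∘ idto e = idm alg_obj
}.

Record ribbonAlgebra (C : braidedAbCategory) := RibbonAlgebra {
  ralg :> algebra C;
  twist : hom ralg ralg;
  twist_iso : exists tau, tau ∘ twist = idm ralg /\ twist ∘ tau = idm ralg;
  twist_mul : amul ralg ∘ (twist ⊗m twist) ∘ braid ralg ralg ∘ braid ralg ralg =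
    twist ∘ amul ralg;
  twist_one : twist ∘ aone ralg = aone ralg
}.

Section CyclicMorphisms.
Variables (C : braidedAbCategory) (A : ribbonAlgebra C).

Local Notation wA := (wobj (alg_obj (ralg A))).
Local Notation mul := (emb_tens (amul A)).
Local Notation eta := (emb_one (aone A)).
Local Notation sigma := (emb (twist A)).

Fixpoint spow (n : nat) : word C := if n is n'.+1 then wA ++ spow n' else [::].

Lemma spowD i j : spow (i + j) = spow i ++ spow j.
Proof. by elim: i => //= i ->; rewrite catA. Qed.

Lemma spowSr n : spow n.+1 = spow n ++ wA.
Proof. by rewrite -addn1 spowD /= cats0. Qed.

Lemma spow_add1 i n : (i <= n)%N -> spow i ++ (wA ++ spow (n - i)) = spow n.+1.
Proof. by move=> ?; rewrite -[wA ++ _]/(spow _.+1) -spowD addnS subnKC. Qed.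

Lemma spow_add2 i n : (i <= n)%N ->
  spow n.+2 = spow i ++ ((wA ++ wA) ++ spow (n - i)).
Proof.
by move=> ?; rewrite -catA -[wA ++ _]/(spow _.+2) -spowD !addnS subnKC.
Qed.

Lemma spow_add0 i n : (i <= n)%N ->
  spow n.+1 = spow i.+1 ++ ([::] ++ spow (n - i)).
Proof. by move=> ?; rewrite cat0s -spowD addSn subnKC. Qed.

Definition C_ n : word C := spow n.+1.

Definition rot n : shom (C_ n) (C_ n) :=
  (sigma ⊠ sid (spow n)) ∙ sbraid (spow n) wA ∙ sidto (spowSr n).

Definition lambda n : shom (C_ n) (C_ n) := rot n *~ (-1) ^+ n.

(* face n i is d_i on C_(n + 1); it is 0 by convention if i > n + 1. *)
Definition face n i : shom (C_ n.+1) (C_ n) :=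
  match @idP (i <= n)%N with
  | ReflectT le_in =>
      sidto (spow_add1 le_in) ∙ (sid (spow i) ⊠ (mul ⊠ sid (spow (n - i)))) ∙
      sidto (spow_add2 le_in)
  | ReflectF _ =>
      if i == n.+1
      then (mul ⊠ sid (spow n)) ∙ sidto (catA wA wA (spow n)) ∙ rot n.+1
      else 0
  end.

(* degen n i is s_i on C_n; it is 0 by convention if i > n. *)
Definition degen n i : shom (C_ n) (C_ n.+1) :=
  match @idP (i <= n)%N with
  | ReflectT le_in =>
      sidto (spow_add1 (le_in : i.+1 <= n.+1)%N) ∙
      (sid (spow i.+1) ⊠ (eta ⊠ sid (spow (n - i)))) ∙
      sidto (spow_add0 le_in)
  | ReflectF _ => 0
  end.

End CyclicMorphisms.

Definition spower (C : braidedAbCategory) (w : word C) (f : shom w w) n :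
  shom w w := iter n (scomp f) (sid w).

(* Main.v *)
From mathcomp Require Import all_boot all_algebra zify.
From mathcomp Require Import boolp.
Require Import Defs.

(** Up to signs, [lambda n] is [rot n]: the last strand of [A^(n+1)] is braided
    with the others to the front and twisted by [sigma].  Three facts about
    [t = rot n] give the whole theorem.

    - Naturality of the braiding: a morphism [f] on some of the first strands
      commutes with the rotation, at the price of moving one place to the right
      ([tau_nat]).  This is (iv) for [i < n] and (v) for [i >= 1].

    - The ribbon axiom: rotating twice brings the last two strands to the front
      and makes them cross twice, so that multiplying them afterwards amounts, by
      [m (sigma (x) sigma) Psi Psi = sigma m], to multiplying them first and
      rotating once ([tau_mul]).  This is (iv) for [i = n], and the only place
      where the axiom on [sigma m] enters.

    - Naturality with respect to the unit: since the braiding with the unit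
      object is the identity and [sigma eta = eta], rotating a unit from the last
      place simply puts it in the first place ([tau_one]).  This gives the formula
      for [s_0 lambda] and, as [d_(n+1) = d_0 rot] on [C_(n+1)], the relation
      [d_(n+1) s_n = id].

    The remaining relations are formal.  The faces [d_i] with [i < n] and all the
    degeneracies act on consecutive strands; they satisfy the simplicial
    identities by bifunctoriality ([pad_far]), associativity and unitality.  The
    last face is [d_0 rot], so that the identities where it occurs follow from
    the previous ones by moving rotations to the right.  For (vi) and (vii) one
    writes [t^(n+1) = t^i t t^(n-i)]: the operator of index [i] goes down to index
    [0] along [t^i], jumps to the last index along [t], and comes back to [i]
    along [t^(n-i)].  The signs cancel because [n (n + 1)] is even.

    Before this, the strict extension has to be shown to be a strict braided
    category.  Choosing the right-nested bracketing of each word embeds it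
    faithfully into [C]; concatenation is then carried to the tensor product
    along isomorphisms [phi], whose compatibility with the associativity of
    [C] ([phi_assoc]) comes from the coherence theorem.  Strictness is a matter of
    provable, not definitional, equality of words: morphisms are therefore
    bundled with their source and target into a type [arrow], in which the strict
    laws are plain equations ([atensA], [abraid_catl], ...) that can be used
    for rewriting. *)

Set Implicit Arguments.
Unset Strict Implicit.
Unset Printing Implicit Defensive.

Import GRing.Theory.
Local Open Scope ring_scope.

(** * The strict extension is a strict braided Ab-category *)

Section StrictLaws.
Variable C : braidedAbCategory.
Implicit Types (u v w x : word C).

Lemma scompA u v w x (h : shom w x) (g : shom v w) (f : shom u v) :
  h ∙ (g ∙ f) = h ∙ g ∙ f.
Proof. by rewrite /scomp !mclassK compA. Qed.

Lemma scomp1m u v (f : shom u v) : sid v ∙ f = f.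
Proof. by rewrite /scomp /sid mclassK comp1m repK. Qed.

Lemma scompm1 u v (f : shom u v) : f ∙ sid u = f.
Proof. by rewrite /scomp /sid mclassK compm1 repK. Qed.

Lemma scompDl u v w (g g' : shom v w) (f : shom u v) :
  (g + g') ∙ f = g ∙ f + g' ∙ f.
Proof.
rewrite -(repK g (std v) (std w)) -(repK g' (std v) (std w)).
rewrite -(repK f (std u) (std v)).
by rewrite add_classE !comp_classE compDl add_classE.
Qed.

Lemma scompDr u v w (g : shom v w) (f f' : shom u v) :
  g ∙ (f + f') = g ∙ f + g ∙ f'.
Proof.
rewrite -(repK g (std v) (std w)) -(repK f (std u) (std v)).
rewrite -(repK f' (std u) (std v)).
by rewrite add_classE !comp_classE compDr add_classE.
Qed.

Lemma scomp0m u v w (f : shom u v) : (0 : shom v w) ∙ f = 0.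
Proof. by apply: (addrI (0 ∙ f)); rewrite -scompDl !addr0. Qed.

Lemma scompm0 u v w (g : shom v w) : g ∙ (0 : shom u v) = 0.
Proof. by apply: (addrI (g ∙ 0)); rewrite -scompDr !addr0. Qed.

Lemma scompNl u v w (g : shom v w) (f : shom u v) : (- g) ∙ f = - (g ∙ f).
Proof. by apply: (addrI (g ∙ f)); rewrite -scompDl !subrr scomp0m. Qed.

Lemma scompNr u v w (g : shom v w) (f : shom u v) : g ∙ (- f) = - (g ∙ f).
Proof. by apply: (addrI (g ∙ f)); rewrite -scompDr !subrr scompm0. Qed.

Lemma sidtoE w (e : w = w) : sidto e = sid w.
Proof. by rewrite (Prop_irrelevance e erefl). Qed.

Lemma coh_idto (s t : btree C) (st : s = t) (e : leaves s = leaves t) :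
  coh (maclane C) e = idto (congr1 (@bobj C) st).
Proof. by subst t; rewrite idtoE coherence_refl. Qed.

(** Identities along equalities of words are themselves classes of coherence
    isomorphisms, for whatever bracketings are convenient. *)
Lemma sidto_classE w w' (e : w = w') (a : bracketing w) (b : bracketing w')
    (el : leaves a = leaves b) :
  sidto e = mclass (coh (maclane C) el).
Proof.
subst w'; rewrite sidtoE; apply: (@rep_inj _ _ _ _ _ a b); rewrite mclassK.
rewrite -(sid_classE a) repE rebracket_id !compm1.
by congr (coh _ _); apply: Prop_irrelevance.
Qed.

(** The value of a word for its standard bracketing.  As each class of morphisms
    has exactly one representative with given bracketings, [evm] is a faithful
    functor from the strict extension to [C]. *)
Definition ev w : C := bobj (std w).
Definition evm w w' (f : shom w w') : hom (ev w) (ev w') :=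
  locked (rep f (std w) (std w')).

Lemma evmE w w' (f : shom w w') : evm f = rep f (std w) (std w').
Proof. by rewrite /evm -lock. Qed.

Lemma evm_inj w w' (f g : shom w w') : evm f = evm g -> f = g.
Proof. by rewrite !evmE => /rep_inj. Qed.

Lemma evm_comp u v w (g : shom v w) (f : shom u v) :
  evm (g ∙ f) = evm g ∘ evm f.
Proof. by rewrite !evmE; apply: mclassK. Qed.

Lemma evm_id w : evm (sid w) = idm (ev w).
Proof. by rewrite !evmE; apply: mclassK. Qed.

Lemma evm_sidto w w' (e : w = w') : evm (sidto e) = idto (congr1 ev e).
Proof. by subst w'; rewrite idtoE -evm_id. Qed.

(** The canonical morphism to an arbitrary bracketing [c] of a concatenation.  The
    identity along [bobj_joinb] accounts for the erasure of empty words. *)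
Definition join_to w w' (a : bracketing w) (b : bracketing w')
    (c : bracketing (w ++ w')) : hom (bobj a ⊗ bobj b) (bobj c) :=
  rebracket (joinb a b) c ∘ idto (esym (bobj_joinb a b)).

(** [ev] is monoidal up to the coherence isomorphisms [phi].  These, as well as
    [evm], are locked to keep unification from unfolding them to [comp]. *)
Definition phi u v : hom (ev u ⊗ ev v) (ev (u ++ v)) :=
  locked (join_to (std u) (std v) (std (u ++ v))).

Definition phiV u v : hom (ev (u ++ v)) (ev u ⊗ ev v) :=
  locked (idto (bobj_joinb (std u) (std v)) ∘ rebracket _ _).

Lemma phiK u v : phiV u v ∘ phi u v = idm _.
Proof.
rewrite /phi /phiV -!lock /join_to -!compA (compA (rebracket _ _)) rebracket_comp.
by rewrite rebracket_id comp1m idtoK.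
Qed.

Lemma phiVK u v : phi u v ∘ phiV u v = idm _.
Proof.
rewrite /phi /phiV -!lock /join_to -!compA (compA (idto _)) idtoK comp1m.
by rewrite rebracket_comp rebracket_id.
Qed.

Lemma evm_join u v u' v' (f : hom (ev u ⊗ ev v) (ev u' ⊗ ev v')) :
  evm (join_class f) = phi u' v' ∘ f ∘ phiV u v.
Proof. by rewrite evmE /join_class repE /phi /phiV -!lock !compA. Qed.

Lemma evm_tens u v u' v' (f : shom u u') (g : shom v v') :
  evm (f ⊠ g) = phi u' v' ∘ (evm f ⊗m evm g) ∘ phiV u v.
Proof. by rewrite !(evmE f, evmE g); apply: evm_join. Qed.

Lemma evm_braid u v :
  evm (sbraid u v) = phi v u ∘ braid (ev u) (ev v) ∘ phiV u v.
Proof. exact: evm_join. Qed.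

(** The statement of the next lemma, when one of the three words is empty: the
    two trees are then equal, and everything in sight is an identity along an
    equality of objects. *)
Lemma coh_joinb_assoc_idto u v w (a : bracketing u) (b : bracketing v)
    (c : bracketing w)
    (st : btree_of (joinb a (joinb b c)) = joinb (joinb a b) c)
    (e : leaves (joinb a (joinb b c)) = leaves (joinb (joinb a b) c))
    (r : bobj a ⊗ (bobj b ⊗ bobj c) = (bobj a ⊗ bobj b) ⊗ bobj c) :
  assoc (bobj a) (bobj b) (bobj c) = idto r ->
  (idto (bobj_joinb a b) ⊗m idm (bobj c)) ∘ idto (bobj_joinb (joinb a b) c) ∘
    coh (maclane C) e =
  assoc (bobj a) (bobj b) (bobj c) ∘
    (idm (bobj a) ⊗m idto (bobj_joinb b c)) ∘ idto (bobj_joinb a (joinb b c)).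
Proof.
move=> ->; rewrite -[idm (bobj c)](idtoE erefl) -[idm (bobj a)](idtoE erefl).
rewrite (idto_tens _ _ (congr1 (fun X : C => X ⊗ bobj c) (bobj_joinb a b))).
rewrite (idto_tens _ _ (congr1 (fun X : C => bobj a ⊗ X) (bobj_joinb b c))).
by rewrite (coh_idto st) !idto_comp; apply: idto_irr.
Qed.

(** The only point where the reassociation of words meets that of [C]: [joinb]
    erases empty words, and on these [assoc] is an identity. *)
Lemma coh_joinb_assoc u v w (a : bracketing u) (b : bracketing v)
    (c : bracketing w)
    (e : leaves (joinb a (joinb b c)) = leaves (joinb (joinb a b) c)) :
  (idto (bobj_joinb a b) ⊗m idm (bobj c)) ∘ idto (bobj_joinb (joinb a b) c) ∘
    coh (maclane C) e =
  assoc (bobj a) (bobj b) (bobj c) ∘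
    (idm (bobj a) ⊗m idto (bobj_joinb b c)) ∘ idto (bobj_joinb a (joinb b c)).
Proof.
case: u a e => [|l u] a e.
  have o : bobj a = one by rewrite oneb_uniq.
  have r : bobj a ⊗ (bobj b ⊗ bobj c) = (bobj a ⊗ bobj b) ⊗ bobj c.
    by rewrite o !tens1o.
  apply: (@coh_joinb_assoc_idto _ _ _ _ _ _ _ _ r) => //.
  by move: r; rewrite o; apply: assoc1oo.
case: v b e => [|m v] b e.
  have o : bobj b = one by rewrite oneb_uniq.
  have r : bobj a ⊗ (bobj b ⊗ bobj c) = (bobj a ⊗ bobj b) ⊗ bobj c.
    by rewrite o tens1o tenso1.
  apply: (@coh_joinb_assoc_idto _ _ _ _ _ _ _ _ r); first by case: w c {e r}.
  by move: r; rewrite o; apply: assoco1o.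
case: w c e => [|n w] c e.
  have o : bobj c = one by rewrite oneb_uniq.
  have r : bobj a ⊗ (bobj b ⊗ bobj c) = (bobj a ⊗ bobj b) ⊗ bobj c.
    by rewrite o !tenso1.
  apply: (@coh_joinb_assoc_idto _ _ _ _ _ _ _ _ r) => //.
  by move: r; rewrite o; apply: assocoo1.
by rewrite !idtoE !tensm_id !comp1m !compm1; apply: coh_assoc.
Qed.

Lemma join_to_rebracket u v (a a' : bracketing u) (b b' : bracketing v)
    (c : bracketing (u ++ v)) :
  join_to a' b' c ∘ (rebracket a a' ⊗m rebracket b b') = join_to a b c.
Proof. by rewrite /join_to -compA -rebracket_joinl compA rebracket_comp. Qed.

Lemma idto_ev w w' (e : w = w') (el : leaves (std w) = leaves (std w')) :
  idto (congr1 ev e) = coh (maclane C) el.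
Proof. by subst w'; rewrite idtoE coherence_refl. Qed.

Lemma join_to_l u v w (a : bracketing u) (b : bracketing v)
    (ab : bracketing (u ++ v)) (c : bracketing w) (d : bracketing ((u ++ v) ++ w)) :
  join_to ab c d ∘ (join_to a b ab ⊗m idm (bobj c)) =
  join_to (joinb a b) c d ∘ (idto (esym (bobj_joinb a b)) ⊗m idm (bobj c)).
Proof. by rewrite tensm_idr -(rebracket_id c) compA join_to_rebracket. Qed.

Lemma join_to_r u v w (a : bracketing u) (b : bracketing v) (c : bracketing w)
    (bc : bracketing (v ++ w)) (d : bracketing (u ++ (v ++ w))) :
  join_to a bc d ∘ (idm (bobj a) ⊗m join_to b c bc) =
  join_to a (joinb b c) d ∘ (idm (bobj a) ⊗m idto (esym (bobj_joinb b c))).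
Proof. by rewrite tensm_idl -(rebracket_id a) compA join_to_rebracket. Qed.

(** Both sides reassociate [u], [v], [w] and go to the standard bracketing of the
    concatenated word; they agree because the two routes are made of coherence
    isomorphisms between the same trees. *)
Lemma phi_assoc u v w :
  phi (u ++ v) w ∘ (phi u v ⊗m idm (ev w)) ∘ assoc (ev u) (ev v) (ev w) =
  idto (congr1 ev (catA u v w)) ∘ phi u (v ++ w) ∘ (idm (ev u) ⊗m phi v w).
Proof.
rewrite -[RHS]compA /phi -!lock join_to_l join_to_r.
set a := std u; set b := std v; set c := std w.
have el : leaves (joinb a (joinb b c)) = leaves (joinb (joinb a b) c).
  by rewrite !leaves_btree catA.
have es : leaves (std (u ++ (v ++ w))) = leaves (std ((u ++ v) ++ w)).
  by rewrite catA.
have e3 : leaves (joinb a (joinb b c)) = leaves (std ((u ++ v) ++ w)).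
  by rewrite el leaves_btree [RHS]leaves_btree.
rewrite (idto_ev (catA u v w) es) /join_to !compA.
rewrite /rebracket (coh_trans _ _ _ e3).
rewrite -(coh_trans _ el (etrans (leaves_btree _) (esym (leaves_btree _))) e3).
rewrite -!compA; congr (_ ∘ _).
set p := idto (esym (bobj_joinb (joinb a b) c)).
set q := idto (esym (bobj_joinb a b)) ⊗m idm (bobj c).
set r := idto (esym (bobj_joinb a (joinb b c))).
set s := idm (bobj a) ⊗m idto (esym (bobj_joinb b c)).
(* [p ∘ q] and [r ∘ s] are the inverses of the outer factors of the two sides of
   [coh_joinb_assoc]. *)
have rs : (idm (bobj a) ⊗m idto (bobj_joinb b c)) ∘
    idto (bobj_joinb a (joinb b c)) ∘ r ∘ s = idm _.
  by rewrite -!compA (compA (idto _)) idtoK comp1m -tensm_idl idtoK tensm_id.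
have qp : p ∘ q ∘ (idto (bobj_joinb a b) ⊗m idm (bobj c)) ∘
    idto (bobj_joinb (joinb a b) c) = idm _.
  by rewrite -!compA (compA (_ ⊗m _)) -tensm_idr idtoK tensm_id comp1m idtoK.
rewrite -[LHS]compm1 -rs -[RHS]comp1m -qp.
move: (coh_joinb_assoc el) => /(congr1 (fun f => p ∘ q ∘ f ∘ r ∘ s)).
by rewrite !compA => ->.
Qed.

Lemma ev_cats0 w : ev w = ev (w ++ [::]).
Proof. by rewrite cats0. Qed.

Lemma phi1w w (e : one ⊗ ev w = ev w) : phi [::] w = idto e.
Proof.
rewrite /phi -lock /join_to /rebracket (coh_idto (erefl : btree_of _ = btree_of _)).
by rewrite idto_comp; apply: idto_irr.
Qed.

Lemma phiw1 w (e : ev w ⊗ one = ev (w ++ [::])) : phi w [::] = idto e.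
Proof.
rewrite /phi -lock /join_to /rebracket.
have st : btree_of (joinb (std w) (std [::])) = std (w ++ [::]).
  by case: w {e} => //= l w; rewrite cats0.
by rewrite (coh_idto st) idto_comp; apply: idto_irr.
Qed.

Lemma stens_id u v : sid u ⊠ sid v = sid (u ++ v).
Proof. by apply: evm_inj; rewrite evm_tens !evm_id tensm_id compm1 phiVK. Qed.

Lemma stens_comp u u' u'' v v' v'' (f' : shom u' u'') (f : shom u u')
    (g' : shom v' v'') (g : shom v v') :
  (f' ∙ f) ⊠ (g' ∙ g) = (f' ⊠ g') ∙ (f ⊠ g).
Proof.
apply: evm_inj; rewrite evm_comp !evm_tens !evm_comp tensm_comp -!compA.
by rewrite (compA (phiV _ _)) phiK comp1m.
Qed.

Lemma phi_evm u u' v v' (f : shom u u') (g : shom v v') :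
  evm (f ⊠ g) ∘ phi u v = phi u' v' ∘ (evm f ⊗m evm g).
Proof. by rewrite evm_tens -compA phiK compm1. Qed.

Lemma phi_epi u v (X : C) (f g : hom (ev (u ++ v)) X) :
  f ∘ phi u v = g ∘ phi u v -> f = g.
Proof.
by move=> fg; rewrite -[f]compm1 -[g]compm1 -phiVK !compA fg.
Qed.

Lemma phi2_epi u v w (X : C) (f g : hom (ev (u ++ (v ++ w))) X) :
  f ∘ phi u (v ++ w) ∘ (idm _ ⊗m phi v w) =
  g ∘ phi u (v ++ w) ∘ (idm _ ⊗m phi v w) -> f = g.
Proof.
move=> /(congr1 (fun h => h ∘ (idm _ ⊗m phiV v w))).
by rewrite -!compA -tensm_idl phiVK tensm_id compm1 => /phi_epi.
Qed.

(** Naturality of the associator of [C], transported along [phi]. *)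
Lemma stensA u u' v v' w w' (f : shom u u') (g : shom v v') (h : shom w w') :
  sidto (catA u' v' w') ∙ (f ⊠ (g ⊠ h)) =
  ((f ⊠ g) ⊠ h) ∙ sidto (catA u v w).
Proof.
apply: evm_inj; rewrite !evm_comp !evm_sidto; apply: phi2_epi.
rewrite -!compA.
rewrite (compA (evm (f ⊠ _))) phi_evm -!compA -tensm_comp compm1 phi_evm.
rewrite -[in LHS](comp1m (evm f)) tensm_comp !compA -phi_assoc.
rewrite -(compA _ (idto _)) -(compA _ _ (idm _ ⊗m phi _ _)) -phi_assoc.
rewrite -!compA assoc_nat !compA; congr (_ ∘ _).
by rewrite phi_evm -!compA -!tensm_comp phi_evm compm1 comp1m.
Qed.

Lemma stens1m u v (f : shom u v) : sid [::] ⊠ f = f.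
Proof.
apply: evm_inj; apply: (@phi_epi [::]); rewrite phi_evm evm_id.
by rewrite !(phi1w (tens1o _)); apply: tens1m.
Qed.

Lemma stensm1 u v (f : shom u v) :
  (f ⊠ sid [::]) ∙ sidto (esym (cats0 u)) = sidto (esym (cats0 v)) ∙ f.
Proof.
have K w : phi w [::] ∘ idto (esym (tenso1 _)) = idto (ev_cats0 w).
  rewrite (phiw1 (etrans (tenso1 _) (ev_cats0 w))) idto_comp; exact: idto_irr.
apply: evm_inj; rewrite !evm_comp !evm_sidto !(idto_irr _ (ev_cats0 _)) -!K.
rewrite compA phi_evm evm_id -!compA; congr (_ ∘ _).
have -> : evm f ⊗m idm (ev [::]) = _ :=
  tensm1E (evm f) (tenso1 _) (esym (tenso1 _)).
by rewrite -!compA (idtoK (esym _)) compm1.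
Qed.

Lemma sbraid_nat u u' v v' (f : shom u u') (g : shom v v') :
  sbraid u' v' ∙ (f ⊠ g) = (g ⊠ f) ∙ sbraid u v.
Proof.
apply: evm_inj; rewrite !evm_comp !evm_braid !evm_tens -!compA.
rewrite (compA (phiV _ _)) phiK comp1m [in RHS](compA (phiV _ _)) phiK comp1m.
by rewrite (compA (braid _ _)) braid_nat !compA.
Qed.

Lemma phi_braid u v : evm (sbraid u v) ∘ phi u v = phi v u ∘ braid _ _.
Proof. by rewrite evm_braid -compA phiK compm1. Qed.

Lemma sbraidw1 w : sbraid w [::] = sidto (cats0 w).
Proof.
apply: evm_inj; apply: phi_epi; rewrite phi_braid evm_sidto.
rewrite (phi1w (tens1o _)) (phiw1 (etrans (tenso1 _) (ev_cats0 w))).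
rewrite (braid_o1 (etrans (tenso1 _) (esym (tens1o _)))) !idto_comp.
exact: idto_irr.
Qed.

(** The hexagon of [C], transported along [phi]: precomposed with the coherence
    isomorphism from [ev u ⊗ (ev v ⊗ ev w)], the two sides become those of
    [hexagonl], followed by one and the same isomorphism. *)
Lemma shexagonl u v w :
  sidto (catA w u v) ∙ sbraid (u ++ v) w ∙ sidto (catA u v w) =
  (sbraid u w ⊠ sid v) ∙ sidto (catA u w v) ∙ (sid u ⊠ sbraid v w).
Proof.
apply: evm_inj; rewrite !evm_comp !evm_sidto; apply: phi2_epi.
transitivity (phi (w ++ u) v ∘ (phi w u ⊗m idm _) ∘
  (assoc _ _ _ ∘ (braid (ev u ⊗ ev v) (ev w) ∘ assoc _ _ _))).
  rewrite !compA phi_assoc -!compA; congr (_ ∘ _).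
  rewrite (compA (idto _)) (compA _ (idm _ ⊗m _)) -phi_assoc -!compA.
  rewrite (compA (evm _)) phi_braid -!compA; congr (_ ∘ _).
  by rewrite !compA braid_nat.
rewrite hexagonl !compA -!compA (compA (evm (sid u ⊠ _))) phi_evm evm_id.
rewrite -!compA -tensm_idl phi_braid tensm_idl !compA.
rewrite -(compA _ (idto _)) -(compA _ _ (idm _ ⊗m phi _ _)) -phi_assoc.
rewrite !compA phi_evm evm_id.
by rewrite -(compA _ (_ ⊗m _) (phi u w ⊗m _)) -!tensm_idr phi_braid tensm_idr !compA.
Qed.

Lemma phi_assocV u v w :
  idto (congr1 ev (esym (catA u v w))) ∘ phi (u ++ v) w ∘
    (phi u v ⊗m idm (ev w)) =
  phi u (v ++ w) ∘ (idm (ev u) ⊗m phi v w) ∘ assocV (ev u) (ev v) (ev w).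
Proof.
rewrite -[LHS]compm1 -(assocVK (ev u)) !compA; congr (_ ∘ _).
rewrite -!(compA (idto _)) phi_assoc !compA idto_comp idtoE.
by rewrite comp1m.
Qed.

Lemma phi2_epiV u v w (X : C) (f g : hom (ev ((u ++ v) ++ w)) X) :
  f ∘ phi (u ++ v) w ∘ (phi u v ⊗m idm _) =
  g ∘ phi (u ++ v) w ∘ (phi u v ⊗m idm _) -> f = g.
Proof.
move=> /(congr1 (fun h => h ∘ (phiV u v ⊗m idm _))).
by rewrite -!compA -tensm_idr phiVK tensm_id compm1 => /phi_epi.
Qed.

Lemma shexagonr u v w :
  sidto (esym (catA v w u)) ∙ sbraid u (v ++ w) ∙ sidto (esym (catA u v w)) =
  (sid v ⊠ sbraid u w) ∙ sidto (esym (catA v u w)) ∙ (sbraid u v ⊠ sid w).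
Proof.
apply: evm_inj; rewrite !evm_comp !evm_sidto; apply: phi2_epiV.
transitivity (phi v (w ++ u) ∘ (idm _ ⊗m phi w u) ∘
  (assocV _ _ _ ∘ (braid (ev u) (ev v ⊗ ev w) ∘ assocV _ _ _))).
  rewrite !compA -phi_assocV -!compA; congr (_ ∘ _).
  rewrite (compA (idto _)) (compA _ (_ ⊗m idm _)) phi_assocV -!compA.
  rewrite (compA (evm _)) phi_braid -!compA; congr (_ ∘ _).
  by rewrite !compA braid_nat.
rewrite hexagonr -!compA (compA (evm (_ ⊠ sid w))) phi_evm evm_id.
rewrite -!compA -tensm_idr phi_braid tensm_idr !compA.
rewrite -(compA _ (idto _)) -(compA _ _ (phi _ _ ⊗m idm _)) phi_assocV.
rewrite !compA phi_evm evm_id.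
by rewrite -(compA _ (_ ⊗m _) (_ ⊗m phi u w)) -!tensm_idl phi_braid tensm_idl !compA.
Qed.

End StrictLaws.

(** * Morphisms bundled with their source and target *)

(** In the strict extension [(u ++ v) ++ w] and [u ++ (v ++ w)] are equal but not
    convertible, so that the strict laws between typed morphisms mention
    identities along equalities.  Between bundled morphisms they do not. *)
Record arrow (C : braidedAbCategory) := Arrow {
  src : word C;
  tgt : word C;
  mor : shom src tgt
}.
Arguments Arrow {C src tgt} mor.

Section Arrows.
Variable C : braidedAbCategory.
Implicit Types (u v w : word C) (f g h : arrow C).

(** Composition of arrows that do not match is zero between the expected words:
    sources and targets of composites can then be computed, and associativity
    holds unconditionally. *)
Definition acomp g f : arrow C := Arrow
  match pselect (tgt f = src g) return shom (src f) (tgt g) with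
  | left e => mor g ∙ sidto e ∙ mor f
  | right _ => 0
  end.

Definition atens f g : arrow C := Arrow (mor f ⊠ mor g).
Definition aid w : arrow C := Arrow (sid w).
Definition abraid u v : arrow C := Arrow (sbraid u v).

Local Notation "g ⋅ f" := (acomp g f) (at level 40, left associativity).
Local Notation "f ⊛ g" := (atens f g) (at level 35, right associativity).

Lemma Arrow_inj u v (f g : shom u v) : Arrow f = Arrow g -> f = g.
Proof.
have gen (a b : arrow C) : a = b -> forall (es : src a = src b) (et : tgt a = tgt b),
    sidto et ∙ mor a = mor b ∙ sidto es.
  by move=> -> es et; rewrite !sidtoE scomp1m scompm1.
by move=> fg; have := gen _ _ fg erefl erefl; rewrite !sidtoE scomp1m scompm1.
Qed.

Lemma Arrow_comp u v w (g : shom v w) (f : shom u v) :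
  Arrow (g ∙ f) = Arrow g ⋅ Arrow f.
Proof.
rewrite /acomp /=; case: pselect => // e.
by rewrite sidtoE scompm1.
Qed.

Lemma Arrow_tens u u' v v' (f : shom u u') (g : shom v v') :
  Arrow (f ⊠ g) = Arrow f ⊛ Arrow g.
Proof. by []. Qed.

Lemma Arrow_sidto u v (e : u = v) : Arrow (sidto e) = aid v.
Proof. by subst v. Qed.

Lemma acompA h g f : h ⋅ (g ⋅ f) = h ⋅ g ⋅ f.
Proof.
case: f g h => [a b f] [c d g] [p q h]; rewrite /acomp /=.
case: (pselect (b = c)) => [e|e]; case: (pselect (d = p)) => [e'|e'].
- by rewrite !scompA.
- by rewrite !scomp0m.
- by rewrite scompm0.
- by [].
Qed.

Lemma acomp1m w f : tgt f = w -> aid w ⋅ f = f.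
Proof.
move=> <-; case: f => [a b f]; rewrite /acomp /=; case: pselect => // e.
by rewrite sidtoE !scomp1m.
Qed.

Lemma acompm1 w f : src f = w -> f ⋅ aid w = f.
Proof.
move=> <-; case: f => [a b f]; rewrite /acomp /=; case: pselect => // e.
by rewrite sidtoE !scompm1.
Qed.

Lemma atensA f g h : f ⊛ (g ⊛ h) = (f ⊛ g) ⊛ h.
Proof.
case: f g h => [a b f] [c d g] [p q h].
rewrite -!Arrow_tens.
rewrite -[LHS](@acomp1m ((b ++ d) ++ q)); last by rewrite /= catA.
by rewrite -(Arrow_sidto (catA b d q)) -Arrow_comp stensA Arrow_comp Arrow_sidto acompm1.
Qed.

Lemma atens_id u v : aid u ⊛ aid v = aid (u ++ v).
Proof. by rewrite -Arrow_tens stens_id. Qed.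

Lemma atens1m f : aid [::] ⊛ f = f.
Proof. by case: f => [a b f]; rewrite -Arrow_tens stens1m. Qed.

Lemma atensm1 f : f ⊛ aid [::] = f.
Proof.
case: f => [a b f]; rewrite -Arrow_tens.
rewrite -[LHS](@acompm1 (a ++ [::])) // -(Arrow_sidto (esym (cats0 a))).
by rewrite -Arrow_comp stensm1 Arrow_comp Arrow_sidto acomp1m ?cats0.
Qed.

Lemma atens_comp f' f g' g : src f' = tgt f -> src g' = tgt g ->
  (f' ⊛ g') ⋅ (f ⊛ g) = (f' ⋅ f) ⊛ (g' ⋅ g).
Proof.
case: f f' g g' => [a b f] [a' b' f'] [c d g] [c' d' g'] /= ef eg.
subst a' c'.
by rewrite -(Arrow_comp f' f) -(Arrow_comp g' g) -!Arrow_tens stens_comp Arrow_comp.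
Qed.

Lemma abraid_nat f g :
  abraid (tgt f) (tgt g) ⋅ (f ⊛ g) = (g ⊛ f) ⋅ abraid (src f) (src g).
Proof.
case: f g => [a b f] [c d g] /=.
by rewrite -!Arrow_tens -Arrow_comp sbraid_nat Arrow_comp.
Qed.

Lemma abraidw1 w : abraid w [::] = aid w.
Proof. by rewrite /abraid sbraidw1 Arrow_sidto. Qed.

Lemma abraid_catl u v w :
  abraid (u ++ v) w = (abraid u w ⊛ aid v) ⋅ (aid u ⊛ abraid v w).
Proof.
have /(congr1 Arrow) := shexagonl u v w.
rewrite !Arrow_comp !Arrow_sidto !Arrow_tens acomp1m /=; last by rewrite catA.
by do 2![rewrite acompm1; last by rewrite /= ?catA].
Qed.

Lemma abraid_catr u v w :
  abraid u (v ++ w) = (aid v ⊛ abraid u w) ⋅ (abraid u v ⊛ aid w).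
Proof.
have /(congr1 Arrow) := shexagonr u v w.
rewrite !Arrow_comp !Arrow_sidto !Arrow_tens acomp1m /=; last by rewrite catA.
by do 2![rewrite acompm1; last by rewrite /= ?catA].
Qed.

End Arrows.

Notation "g ⋅ f" := (acomp g f) (at level 40, left associativity).
Notation "f ⊛ g" := (atens f g) (at level 35, right associativity).

(** * Ribbon algebras in the strict extension *)

Section Ribbon.
Variables (C : braidedAbCategory) (A : ribbonAlgebra C).

Local Notation wA := (wobj (alg_obj (ralg A))).

Definition mulA := Arrow (emb_tens (amul A)).
Definition oneA := Arrow (emb_one (aone A)).
Definition twistA := Arrow (emb (twist A)).

Lemma mulA_assoc : mulA ⋅ (aid wA ⊛ mulA) = mulA ⋅ (mulA ⊛ aid wA).
Proof.
have /(congr1 Arrow) := amulA A.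
by rewrite !Arrow_comp !Arrow_sidto !Arrow_tens acompm1 //= catA.
Qed.

(** A class represented by an identity of objects of [C] is an identity; this
    turns the unit axioms of [C], stated along equalities, into strict ones. *)
Lemma Arrow_class_idto (w w' : word C) (a : bracketing w) (b : bracketing w')
    (f : hom (bobj a) (bobj b)) (ew : w = w') (t : btree_of a = b) :
  f = idto (congr1 (@bobj C) t) -> Arrow (mclass f) = aid w'.
Proof.
move=> ->; have el : leaves a = leaves b by rewrite t.
by rewrite -(coh_idto t el) -(sidto_classE ew) Arrow_sidto.
Qed.

Lemma joinb_one (w : word C) (a : bracketing w) :
  btree_of (joinb a (oneb C)) = a.
Proof. by case: w a => [|l w] a //; rewrite oneb_uniq. Qed.

Lemma mulA_oneAl : mulA ⋅ (oneA ⊛ aid wA) = aid wA.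
Proof.
rewrite -Arrow_tens -Arrow_comp -(sid_classE (leafb A)) tens_classE.
have t : btree_of (joinb (oneb C) (leafb A)) = leafb A by [].
rewrite comp_classE; apply: (Arrow_class_idto _ (t := t)) => //.
rewrite -!compA (compA (idto _) (idto _)) idtoK comp1m compA.
have e : alg_obj A = one ⊗ alg_obj A by rewrite tens1o.
rewrite -[RHS]comp1m -[X in _ = X ∘ _](amul1m e) -[RHS]compA idto_comp.
by congr (_ ∘ _); apply: idto_irr.
Qed.

Lemma mulA_oneAr : mulA ⋅ (aid wA ⊛ oneA) = aid wA.
Proof.
rewrite -Arrow_tens -Arrow_comp -(sid_classE (leafb A)) tens_classE.
rewrite comp_classE; apply: (Arrow_class_idto _ (t := joinb_one (leafb A))).
  by rewrite cats0.
rewrite -!compA (compA (idto _) (idto _)) idtoK comp1m compA.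
have e : alg_obj A = alg_obj A ⊗ one by rewrite tenso1.
rewrite -[RHS]comp1m -[X in _ = X ∘ _](amulm1 e) -[RHS]compA idto_comp.
by congr (_ ∘ _); apply: idto_irr.
Qed.

Lemma twistA_oneA : twistA ⋅ oneA = oneA.
Proof. by rewrite -Arrow_comp comp_classE twist_one. Qed.

Lemma twistA_mulA :
  mulA ⋅ (twistA ⊛ twistA) ⋅ abraid wA wA ⋅ abraid wA wA = twistA ⋅ mulA.
Proof.
have /(congr1 Arrow) : emb_tens (amul A) ∙ (emb (twist A) ⊠ emb (twist A)) ∙
    sbraid wA wA ∙ sbraid wA wA = emb (twist A) ∙ emb_tens (amul A).
  rewrite (braid_classE (leafb A) (leafb A)) tens_classE !comp_classE.
  congr mclass; rewrite [RHS]compA -twist_mul -!compA.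
  by do 3!rewrite (compA (idto _) (idto _)) idtoK comp1m.
by rewrite !Arrow_comp.
Qed.

End Ribbon.

(** * Rotations *)

Section Cyclic.
Variables (C : braidedAbCategory) (A : ribbonAlgebra C).
Implicit Types (f g : arrow C) (w : word C).

Local Notation wA := (wobj (alg_obj (ralg A))).
Local Notation M := (mulA A).
Local Notation E := (oneA A).
Local Notation S := (twistA A).
Local Notation pow := (spow A).

(** The rotation of the last letter [A] of a word [w ++ A] to the front, for an
    arbitrary word [w]; [rot n] is the case of [w = A^n]. *)
Definition tau w := (S ⊛ aid w) ⋅ abraid w wA.

Lemma tau_nat f :
  tau (tgt f) ⋅ (f ⊛ aid wA) = (aid wA ⊛ f) ⋅ tau (src f).
Proof.
rewrite /tau -acompA (abraid_nat f (aid wA)) !acompA; congr (_ ⋅ _).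
by rewrite !atens_comp // !acomp1m ?acompm1.
Qed.

(** The braiding with the unit object is trivial and [sigma] fixes [eta]. *)
Lemma tau_one w : tau w ⋅ (aid w ⊛ E) = E ⊛ aid w.
Proof.
rewrite /tau -acompA (abraid_nat (aid w) E) /= abraidw1 acompm1 //.
by rewrite atens_comp // acomp1m // twistA_oneA.
Qed.

(** Moving the last two strands to the front one after the other: by the two
    hexagons this is moving them together, preceded and followed by a crossing of
    the two; by naturality the first crossing may also be done at the end. *)
Lemma abraid_twice w :
  abraid (wA ++ w) wA ⋅ abraid (w ++ wA) wA =
  ((abraid wA wA ⋅ abraid wA wA) ⊛ aid w) ⋅ abraid w (wA ++ wA).
Proof.
rewrite [abraid (wA ++ w) _]abraid_catl [abraid (w ++ wA) _]abraid_catl.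
rewrite !acompA -(acompA _ _ (_ ⊛ aid wA)) -abraid_catr -acompA.
rewrite (abraid_nat (aid w) (abraid wA wA)) acompA.
by rewrite atens_comp // acomp1m.
Qed.

(** The ribbon axiom in its rotational form: after [abraid_twice], both copies of
    [sigma] and the double crossing sit under [m] and are absorbed by it. *)
Lemma tau_mul w :
  (M ⊛ aid w) ⋅ (tau (wA ++ w) ⋅ tau (w ++ wA)) = tau w ⋅ (aid w ⊛ M).
Proof.
have -> : tau (wA ++ w) ⋅ tau (w ++ wA) =
  (((S ⊛ S) ⋅ abraid wA wA ⋅ abraid wA wA) ⊛ aid w) ⋅ abraid w (wA ++ wA).
  rewrite /tau -!acompA (acompA (abraid (wA ++ w) _)).
  have -> : S ⊛ aid (w ++ wA) = (S ⊛ aid w) ⊛ aid wA.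
    by rewrite -atensA atens_id.
  rewrite (abraid_nat (S ⊛ aid w) (aid wA)) /= -(acompA (aid wA ⊛ _)) abraid_twice.
  have -> : S ⊛ aid (wA ++ w) = S ⊛ (aid wA ⊛ aid w) by rewrite atens_id.
  rewrite !acompA; congr (_ ⋅ _).
  rewrite !atensA !atens_comp //= ?acomp1m ?acompm1 //.
  by rewrite !acompA.
rewrite acompA atens_comp // !acompA twistA_mulA acomp1m //.
rewrite /tau -acompA (abraid_nat (aid w) M) acompA.
by rewrite atens_comp // acomp1m.
Qed.

(** [f] acting on consecutive strands, with [i] strands before and [k] after. *)
Definition pad i f k := aid (pow i) ⊛ (f ⊛ aid (pow k)).

Lemma spow1 : wA = pow 1.
Proof. by rewrite /= cats0. Qed.

Lemma pad_comp i f g k : src g = tgt f ->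
  pad i g k ⋅ pad i f k = pad i (g ⋅ f) k.
Proof. by move=> e; rewrite !atens_comp /= ?e // !acomp1m. Qed.

Lemma pad_tensl i f k : pad i (aid wA ⊛ f) k = pad i.+1 f k.
Proof. by rewrite /pad -addn1 spowD -spow1 -atens_id !atensA. Qed.

Lemma pad_tensr i f k : pad i (f ⊛ aid wA) k = pad i f k.+1.
Proof. by rewrite /pad -add1n spowD -spow1 -atens_id !atensA. Qed.

(** Operators on disjoint groups of strands commute; the second one is shifted by
    the change in the number of strands made by the first. *)
Lemma pad_far a b c d f g i p q :
    src f = pow a -> tgt f = pow b -> src g = pow c -> tgt g = pow d ->
  pad i f (p + d + q) ⋅ pad (i + a + p) g q =
  pad (i + b + p) g q ⋅ pad i f (p + c + q).
Proof.
move=> sf tf sg tg.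
rewrite /pad !spowD -sf -tf -sg -tg -!atens_id.
by rewrite -!atensA !atens_comp //= ?acomp1m ?acompm1.
Qed.

Lemma pad_tau i f k c d : src f = pow c -> tgt f = pow d ->
  pad i.+1 f k ⋅ tau (pow (i + c + k)) = tau (pow (i + d + k)) ⋅ pad i f k.+1.
Proof.
move=> sf tf; have := tau_nat (pad i f k).
rewrite /= sf tf -!spowD !addnA => h.
transitivity ((aid wA ⊛ pad i f k) ⋅ tau (pow (i + c + k))).
  by rewrite /pad [in RHS]atensA atens_id.
by rewrite -h /pad -!atensA atens_id -spowSr.
Qed.

Lemma Arrow_rot n : Arrow (rot A n) = tau (pow n).
Proof. by rewrite !Arrow_comp Arrow_sidto acompm1. Qed.

Lemma Arrow_face n i : (i <= n)%N -> Arrow (face A n i) = pad i M (n - i).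
Proof.
move=> le_in; rewrite /face; case: {-}_ / idP => // ?.
rewrite !Arrow_comp !Arrow_sidto acomp1m; last by rewrite /= spow_add1.
by rewrite acompm1 //=; rewrite -(spow_add2 A le_in).
Qed.

Lemma Arrow_face_last n :
  Arrow (face A n n.+1) = (M ⊛ aid (pow n)) ⋅ tau (pow n.+1).
Proof.
rewrite /face; case: {-}_ / idP => [lt_nn|_].
  by case/negP: (negbT (ltnn n)).
by rewrite eqxx 2!Arrow_comp Arrow_sidto Arrow_rot acompm1 //= catA.
Qed.

Lemma Arrow_degen n i : (i <= n)%N -> Arrow (degen A n i) = pad i.+1 E (n - i).
Proof.
move=> le_in; rewrite /degen; case: {-}_ / idP => // ?.
rewrite !Arrow_comp !Arrow_sidto acomp1m; last first.
  by rewrite /= (spow_add1 A (le_in : i.+1 <= n.+1)%N).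
by rewrite acompm1 //=; rewrite -(spow_add0 A le_in).
Qed.

End Cyclic.

(** * Relations between faces, degeneracies and rotations *)

Section Relations.
Variables (C : braidedAbCategory) (A : ribbonAlgebra C).

Local Notation M := (mulA A).
Local Notation E := (oneA A).
Local Notation pow := (spow A).
Local Notation pad := (pad A).

Lemma src_mulA : src M = pow 2. Proof. by rewrite /= cats0. Qed.
Lemma tgt_mulA : tgt M = pow 1. Proof. by rewrite /= cats0. Qed.
Lemma src_oneA : src E = pow 0. Proof. by []. Qed.
Lemma tgt_oneA : tgt E = pow 1. Proof. by rewrite /= cats0. Qed.

Lemma pad_mul_mul i k : pad i M k ⋅ pad i.+1 M k = pad i M k ⋅ pad i M k.+1.
Proof.
by rewrite -pad_tensl -pad_tensr !pad_comp ?mulA_assoc.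
Qed.

Lemma pad_mul_onel i k : pad i M k ⋅ pad i E k.+1 = aid (pow (i + 1 + k)).
Proof.
by rewrite -pad_tensr pad_comp // mulA_oneAl /pad !atens_id spow1 -!spowD addnA.
Qed.

Lemma pad_mul_oner i k : pad i M k ⋅ pad i.+1 E k = aid (pow (i + 1 + k)).
Proof.
by rewrite -pad_tensl pad_comp // mulA_oneAr /pad !atens_id spow1 -!spowD addnA.
Qed.

Lemma face_face_inner n i j : (i < j <= n.+1)%N ->
  face A n i ∙ face A n.+1 j = face A n j.-1 ∙ face A n.+1 i.
Proof.
case/andP=> ij jn; apply: Arrow_inj;
rewrite [LHS]Arrow_comp [RHS]Arrow_comp !Arrow_face; try lia.
have [->|ne] := eqVneq j i.+1; first by rewrite pad_mul_mul subSn //; lia.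
have := pad_far i (j - i.+2) (n.+1 - j) src_mulA tgt_mulA src_mulA tgt_mulA.
have -> : (i + 2 + (j - i.+2))%N = j by lia.
have -> : (i + 1 + (j - i.+2))%N = j.-1 by lia.
have -> : (j - i.+2 + 1 + (n.+1 - j))%N = (n - i)%N by lia.
have -> : (j - i.+2 + 2 + (n.+1 - j))%N = (n.+1 - i)%N by lia.
by have -> : (n - j.-1)%N = (n.+1 - j)%N by lia.
Qed.

Lemma degen_degen n i j : (i <= j <= n)%N ->
  degen A n.+1 i ∙ degen A n j = degen A n.+1 j.+1 ∙ degen A n i.
Proof.
case/andP=> ij jn; apply: Arrow_inj;
rewrite [LHS]Arrow_comp [RHS]Arrow_comp !Arrow_degen; try lia.
have := pad_far i.+1 (j - i) (n - j) src_oneA tgt_oneA src_oneA tgt_oneA.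
have -> : (i.+1 + 0 + (j - i))%N = j.+1 by lia.
have -> : (i.+1 + 1 + (j - i))%N = j.+2 by lia.
have -> : (j - i + 1 + (n - j))%N = (n.+1 - i)%N by lia.
by have -> : (j - i + 0 + (n - j))%N = (n - i)%N by lia.
Qed.

Lemma face_degen_lt n i j : (i < j <= n.+1)%N ->
  face A n.+1 i ∙ degen A n.+1 j = degen A n j.-1 ∙ face A n i.
Proof.
case/andP=> ij jn; apply: Arrow_inj.
rewrite [LHS]Arrow_comp [RHS]Arrow_comp !Arrow_degen ?Arrow_face; try lia.
have := pad_far i (j - i.+1) (n.+1 - j) src_mulA tgt_mulA src_oneA tgt_oneA.
have -> : (i + 2 + (j - i.+1))%N = j.+1 by lia.
have -> : (i + 1 + (j - i.+1))%N = j by lia.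
have -> : (j - i.+1 + 1 + (n.+1 - j))%N = (n.+1 - i)%N by lia.
have -> : (j - i.+1 + 0 + (n.+1 - j))%N = (n - i)%N by lia.
have -> : (n - j.-1)%N = (n.+1 - j)%N by lia.
by have -> : (j.-1.+1)%N = j by lia.
Qed.

Lemma face_degen_gt_inner n i j : (j.+1 < i <= n.+1)%N ->
  face A n.+1 i ∙ degen A n.+1 j = degen A n j ∙ face A n i.-1.
Proof.
case/andP=> ij jn; apply: Arrow_inj.
rewrite [LHS]Arrow_comp [RHS]Arrow_comp !Arrow_degen ?Arrow_face; try lia.
have := pad_far j.+1 (i - j.+2) (n.+1 - i) src_oneA tgt_oneA src_mulA tgt_mulA.
have -> : (j.+1 + 0 + (i - j.+2))%N = i.-1 by lia.
have -> : (j.+1 + 1 + (i - j.+2))%N = i by lia.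
have -> : (i - j.+2 + 1 + (n.+1 - i))%N = (n - j)%N by lia.
have -> : (i - j.+2 + 2 + (n.+1 - i))%N = (n.+1 - j)%N by lia.
by have -> : (n - i.-1)%N = (n.+1 - i)%N by lia.
Qed.

Lemma face_degen_diag n j : (j <= n)%N -> face A n j ∙ degen A n j = sid (C_ A n).
Proof.
move=> jn; apply: Arrow_inj; rewrite Arrow_comp Arrow_degen // Arrow_face //.
by rewrite pad_mul_oner; congr (aid (pow _)); lia.
Qed.

Lemma face_degen_diagS n j : (j < n)%N ->
  face A n j.+1 ∙ degen A n j = sid (C_ A n).
Proof.
move=> jn; apply: Arrow_inj; rewrite Arrow_comp Arrow_degen ?Arrow_face; try lia.
have -> : (n - j)%N = (n - j.+1).+1 by lia.
by rewrite pad_mul_onel; congr (aid (pow _)); lia.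
Qed.

Lemma face0_rot n : face A n 0 ∙ rot A n.+1 = face A n n.+1.
Proof.
apply: Arrow_inj; rewrite Arrow_comp Arrow_face // Arrow_rot Arrow_face_last.
by rewrite /pad subn0 atens1m.
Qed.

(** For [i = n.+1] the left-hand side is a product after two rotations, and this
    is the ribbon axiom; otherwise it is naturality of the braiding. *)
Lemma face_rot n i : (0 < i <= n.+1)%N ->
  face A n i ∙ rot A n.+1 = rot A n ∙ face A n i.-1.
Proof.
case: i => // i; rewrite /= ltnS leq_eqVlt => /orP[/eqP ->|lt_in].
  apply: Arrow_inj;
  rewrite [LHS]Arrow_comp [RHS]Arrow_comp Arrow_face_last Arrow_face // !Arrow_rot.
  rewrite -acompA {2}[pow n.+1]spowSr tau_mul subnn.
  by rewrite /pad atensm1.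
apply: Arrow_inj;
rewrite [LHS]Arrow_comp [RHS]Arrow_comp !Arrow_face; try lia; rewrite !Arrow_rot.
have := pad_tau i (n - i.+1) src_mulA tgt_mulA.
have -> : (i + 2 + (n - i.+1))%N = n.+1 by lia.
have -> : (i + 1 + (n - i.+1))%N = n by lia.
by have -> : (n - i.+1).+1 = (n - i)%N by lia.
Qed.

Lemma degen_rot n i : (0 < i <= n)%N ->
  degen A n i ∙ rot A n = rot A n.+1 ∙ degen A n i.-1.
Proof.
case: i => // i /= lt_in; apply: Arrow_inj.
rewrite [LHS]Arrow_comp [RHS]Arrow_comp !Arrow_degen; try lia; rewrite !Arrow_rot.
have := pad_tau i.+1 (n - i.+1) src_oneA tgt_oneA.
have -> : (i.+1 + 0 + (n - i.+1))%N = n by lia.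
have -> : (i.+1 + 1 + (n - i.+1))%N = n.+1 by lia.
by have -> : (n - i.+1).+1 = (n - i)%N by lia.
Qed.

Lemma Arrow_rot_degen n :
  Arrow (rot A n.+1 ∙ degen A n n) = pad 0 E n.+1.
Proof.
rewrite Arrow_comp Arrow_rot Arrow_degen // subnn /pad atensm1 tau_one.
by rewrite atens1m.
Qed.

Lemma face0_rot_degen n : face A n 0 ∙ (rot A n.+1 ∙ degen A n n) = sid (C_ A n).
Proof.
apply: Arrow_inj; rewrite Arrow_comp Arrow_rot_degen Arrow_face // subn0.
by rewrite pad_mul_onel.
Qed.

(** The unit put in first place by a first rotation is carried along by a second
    one, which leaves it behind the strand moved to the front. *)
Lemma degen0_rot n :
  degen A n 0 ∙ rot A n = rot A n.+1 ∙ (rot A n.+1 ∙ degen A n n).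
Proof.
apply: Arrow_inj; rewrite Arrow_comp [RHS]Arrow_comp Arrow_rot_degen.
rewrite !Arrow_rot Arrow_degen // subn0.
by have := pad_tau 0 n src_oneA tgt_oneA.
Qed.

(** The last face is [d_0 rot].  Moving the rotations to the right reduces the
    remaining case to [face_face_inner]; when both faces are last faces this
    is done twice. *)
Lemma face_face n i j : (i < j <= n.+2)%N ->
  face A n i ∙ face A n.+1 j = face A n j.-1 ∙ face A n.+1 i.
Proof.
case/andP=> ij; rewrite leq_eqVlt => /orP[/eqP ej|lt_j]; last first.
  by apply: face_face_inner; rewrite ij.
subst j; rewrite /= -(face0_rot n.+1) -(face0_rot n) scompA.
rewrite -[RHS]scompA -[rot _ _ ∙ face _ _ i](@face_rot n.+1 i.+1) ?ltnS //.
rewrite scompA; congr (_ ∙ _).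
have [ei|ne] := eqVneq i n.+1; last by apply/esym/(@face_face_inner n 0 i.+1); lia.
subst i; rewrite -(face0_rot n) -(face0_rot n.+1) -scompA.
rewrite -[rot _ _ ∙ _](@face_rot n.+1 1) // !scompA.
by rewrite (@face_face_inner n 0 1).
Qed.

Lemma face_degen_id n j i : (j <= n)%N -> i = j \/ i = j.+1 ->
  face A n i ∙ degen A n j = sid (C_ A n).
Proof.
move=> jn [->|->]; first exact: face_degen_diag.
move: jn; rewrite leq_eqVlt => /orP[/eqP ->|]; last exact: face_degen_diagS.
by rewrite -face0_rot -scompA face0_rot_degen.
Qed.

Lemma face_degen_gt n i j : (j.+1 < i <= n.+2)%N ->
  face A n.+1 i ∙ degen A n.+1 j = degen A n j ∙ face A n i.-1.
Proof.
case/andP=> ij; rewrite leq_eqVlt => /orP[/eqP ei|lt_i]; last first.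
  by apply: face_degen_gt_inner; rewrite ij.
subst i; rewrite /= -!face0_rot -scompA -[rot _ _ ∙ _](@degen_rot n.+1 j.+1) //.
by rewrite !scompA face_degen_lt.
Qed.

Lemma spowerD (w : word C) (f : shom w w) m n :
  spower f (m + n) = spower f m ∙ spower f n.
Proof.
elim: m => [|m IHm]; first by rewrite scomp1m.
by rewrite addSn /spower /= -!/(spower _ _) IHm scompA.
Qed.

Lemma spower1 (w : word C) (f : shom w w) : spower f 1 = f.
Proof. exact: scompm1. Qed.

Lemma face_rot_pow n i k : (i + k <= n.+1)%N ->
  face A n (i + k) ∙ spower (rot A n.+1) k = spower (rot A n) k ∙ face A n i.
Proof.
elim: k => [|k IHk] le_k; first by rewrite addn0 scompm1 scomp1m.
have e : spower (rot A n.+1) k.+1 = rot A n.+1 ∙ spower (rot A n.+1) k by [].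
rewrite e scompA face_rot; last by lia.
by rewrite addnS /= -scompA IHk ?scompA //; lia.
Qed.

(** The index decreases to [0] along [i] rotations, jumps to [n.+1] along one more,
    and comes back to [i] along the last [n.+1 - i] ones. *)
Lemma face_rot_full n i : (i <= n.+1)%N ->
  face A n i ∙ spower (rot A n.+1) n.+2 = spower (rot A n) n.+1 ∙ face A n i.
Proof.
move=> le_i.
have -> : n.+2 = (i + (1 + (n.+1 - i)))%N by lia.
rewrite !spowerD spower1 scompA -{1}[i]add0n face_rot_pow //.
rewrite -scompA (scompA (face _ _ 0)) face0_rot.
have := @face_rot_pow n i (n.+1 - i); rewrite subnKC // => -> //.
by rewrite scompA -spowerD subnKC.
Qed.

Lemma degen_rot_pow n i k : (i + k <= n)%N ->
  degen A n (i + k) ∙ spower (rot A n) k = spower (rot A n.+1) k ∙ degen A n i.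
Proof.
elim: k => [|k IHk] le_k; first by rewrite addn0 scompm1 scomp1m.
have e : spower (rot A n) k.+1 = rot A n ∙ spower (rot A n) k by [].
rewrite e scompA degen_rot; last by lia.
by rewrite addnS /= -scompA IHk ?scompA //; lia.
Qed.

(** As for the faces, except that the jump from [0] to the last index costs two
    rotations instead of one. *)
Lemma degen_rot_full n i : (i <= n)%N ->
  degen A n i ∙ spower (rot A n) n.+1 = spower (rot A n.+1) n.+2 ∙ degen A n i.
Proof.
move=> le_i.
have -> : spower (rot A n) n.+1 = spower (rot A n) (i + (1 + (n - i))).
  by congr spower; lia.
have -> : n.+2 = (i + (1 + (1 + (n - i))))%N by lia.
rewrite !spowerD !spower1 scompA -{1}[i]add0n degen_rot_pow //.
rewrite -scompA (scompA (degen _ _ 0)) degen0_rot.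
by have := @degen_rot_pow n i (n - i); rewrite subnKC // -!scompA => ->.
Qed.

Lemma scomp_signl (u v w : word C) (g : shom v w) (f : shom u v) n :
  (g *~ (-1) ^+ n) ∙ f = (g ∙ f) *~ (-1) ^+ n.
Proof.
elim: n => [|n IHn]; first by rewrite !mulr1z.
by rewrite exprS mulN1r !mulrNz scompNl IHn.
Qed.

Lemma scomp_signr (u v w : word C) (g : shom v w) (f : shom u v) n :
  g ∙ (f *~ (-1) ^+ n) = (g ∙ f) *~ (-1) ^+ n.
Proof.
elim: n => [|n IHn]; first by rewrite !mulr1z.
by rewrite exprS mulN1r !mulrNz scompNr IHn.
Qed.

Lemma spower_sign (w : word C) (f : shom w w) n k :
  spower (f *~ (-1) ^+ n) k = spower f k *~ (-1) ^+ (n * k).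
Proof.
elim: k => [|k IHk]; first by rewrite muln0 mulr1z.
rewrite -add1n !spowerD !spower1 IHk scomp_signl scomp_signr -mulrzA -exprD.
by rewrite mulnDr muln1 addnC.
Qed.

Lemma spower_lambda n k : ~~ odd (n * k) ->
  spower (lambda A n) k = spower (rot A n) k.
Proof. by move=> /negbTE e; rewrite spower_sign -signr_odd e mulr1z. Qed.

End Relations.

Theorem theorem4 (C : braidedAbCategory) (A : ribbonAlgebra C) :
  (* (i) on C_(n + 2) *)
  (forall n i j : nat, (i < j <= n.+2)%N ->
     face A n i ∙ face A n.+1 j = face A n j.-1 ∙ face A n.+1 i) /\
  (* (ii) on C_n *)
  (forall n i j : nat, (i <= j <= n)%N ->
     degen A n.+1 i ∙ degen A n j = degen A n.+1 j.+1 ∙ degen A n i) /\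
  (* (iii) on C_(n + 1), C_n and C_(n + 1) *)
  [/\ forall n i j : nat, (i < j <= n.+1)%N ->
        face A n.+1 i ∙ degen A n.+1 j = degen A n j.-1 ∙ face A n i,
      forall n i j : nat, (j <= n)%N -> i = j \/ i = j.+1 ->
        face A n i ∙ degen A n j = sid (C_ A n)
    & forall n i j : nat, (j.+1 < i <= n.+2)%N ->
        face A n.+1 i ∙ degen A n.+1 j = degen A n j ∙ face A n i.-1] /\
  (* (iv) on C_(n + 1) *)
  ((forall n i : nat, (1 <= i <= n.+1)%N ->
      face A n i ∙ lambda A n.+1 = - (lambda A n ∙ face A n i.-1)) /\
   (forall n : nat,
      face A n 0 ∙ lambda A n.+1 = face A n n.+1 *~ (-1) ^+ n.+1)) /\
  (* (v) on C_n *)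
  ((forall n i : nat, (1 <= i <= n)%N ->
      degen A n i ∙ lambda A n = - (lambda A n.+1 ∙ degen A n i.-1)) /\
   (forall n : nat,
      degen A n 0 ∙ lambda A n =
      (spower (lambda A n.+1) 2 ∙ degen A n n) *~ (-1) ^+ n)) /\
  (* (vi) on C_(n + 1) *)
  (forall n i : nat, (i <= n.+1)%N ->
     face A n i ∙ spower (lambda A n.+1) n.+2 =
     spower (lambda A n) n.+1 ∙ face A n i) /\
  (* (vii) on C_n *)
  (forall n i : nat, (i <= n)%N ->
     degen A n i ∙ spower (lambda A n) n.+1 =
     spower (lambda A n.+1) n.+2 ∙ degen A n i).
Proof.
have even2 n : ~~ odd (n * n.+1) by rewrite oddM /= andbN.
split; first exact: face_face.
split; first exact: degen_degen.
split; first by split;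
  [exact: face_degen_lt | move=> n i j; exact: face_degen_id
  | exact: face_degen_gt].
split.
  split=> [n i hi | n]; rewrite scomp_signr ?face0_rot //.
  by rewrite face_rot // scomp_signl exprS mulN1r mulrNz.
split.
  split=> [n i hi | n].
    by rewrite scomp_signr scomp_signl degen_rot // exprS mulN1r mulrNz opprK.
  rewrite spower_lambda; last by rewrite oddM andbF.
  by rewrite scomp_signr degen0_rot (spowerD _ 1 1) spower1 scompA.
by split=> n i hi; rewrite !spower_lambda // ?face_rot_full ?degen_rot_full.
Qed.
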